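(* Let $n\ge 1$ be an integer, $t_1,\dots,t_{n+1}\in\mathbb R$, $V=(t_i^{\,j-1})_{1\le i,j\le n+1}$ the corresponding Vandermonde matrix, and $J=\mathrm{diag}((-1)^{i-1})_{1\le i\le n+1}$. Then the matrix $V_J:=VJ$ is strictly totally positive if and only if $0>t_1>\cdots>t_{n+1}$. Moreover, in this case, the bidiagonal decomposition of $V_J$ can be computed to high relative accuracy. Furthermore, for any negative decreasing sequence $0>t_1>\cdots>t_{n+1}$, the computation of the singular values of $V$, of the inverse matrix $V^{-1}$, and of the solution of linear systems $Vc=d$, where the entries of $d=(d_1,\dots,d_{n+1})^T$ have alternating signs, can be performed to high relative accuracy.
   Context: A real matrix is strictly totally positive (STP) if all its minors are positive, and totally positive (TP) if all its minors are nonnegative. Neville elimination of a nonsingular $(n+1)\times(n+1)$ matrix $A$: $A^{(1)}=A$, and $A^{(k+1)}$ is obtained from $A^{(k)}$ by $a^{(k+1)}_{i,j}=a^{(k)}_{i,j}-\frac{a^{(k)}_{i,k}}{a^{(k)}_{i-1,k}}a^{(k)}_{i-1,j}$ for $i\ge k+1$, $j\ge k$ when $a^{(k)}_{i-1,k}\neq 0$, other entries being unchanged. Its multipliers are $m_{i,j}=a^{(j)}_{i,j}/a^{(j)}_{i-1,j}$ (or $0$ if $a^{(j)}_{i-1,j}=0$), $1\le j<i\le n+1$, and its diagonal pivots are $p_{i,i}=a^{(i)}_{i,i}$. A nonsingular TP matrix has the bidiagonal decomposition $A=F_n\cdots F_1DG_1\cdots G_n$, where $D=\mathrm{diag}(p_{1,1},\dots,p_{n+1,n+1})$,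 $F_i$ is unit lower bidiagonal with $(r,r-1)$ entry $0$ for $r\le i$ and $m_{r,r-i}$ for $r\ge i+1$, and $G_i^T$ has the same form with the multipliers $\widetilde m_{i,j}$ of the Neville elimination of $A^T$. High relative accuracy (HRA): a real value $t$ is computed with HRA if the computed value $\tilde t$ satisfies $|t-\tilde t|/|t|<Ku$, where $u$ is the unit round-off of the floating point arithmetic and $K>0$ is a constant independent of the arithmetic precision; a matrix, vector or factorization is computed to HRA when its entries are. A sufficient condition for HRA is the no inaccurate cancellation condition: the algorithm only evaluates products, quotients, sums of numbers of the same sign, subtractions of numbers of opposite sign, or subtractions of initial data. The initial data here are the nodes $t_i$ (and $d$ for linear systems). *)

(* Defs.v *)
From mathcomp Require Import all_boot all_order all_algebra.
From mathcomp Require Import reals.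

Set Implicit Arguments.
Unset Strict Implicit.
Unset Printing Implicit Defensive.

Import Order.TTheory GRing.Theory Num.Theory.
Local Open Scope ring_scope.

(** * Strict total positivity *)

Definition STP (R : realType) (m n : nat) (A : 'M[R]_(m, n)) : Prop :=
  forall (k : nat) (f : 'I_k -> 'I_m) (g : 'I_k -> 'I_n),
    {homo f : i j / (i < j)%N} -> {homo g : i j / (i < j)%N} ->
    0 < \det (mxsub f g A).

(** * Neville elimination and bidiagonal decomposition

  Rows, columns and elimination steps are numbered from 0: [neville A k] is
  the matrix usually written A^(k+1), and the multiplier m_(i+1,j+1) is
  [multiplier A i j]. The factors keep their usual numbers F_1, ..., F_n and
  G_1, ..., G_n. Each [inord] below receives an index at most n. *)

Definition neville_step (R : realType) (n : nat) (k : nat)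
    (A : 'M[R]_n.+1) : 'M[R]_n.+1 :=
  let c : 'I_n.+1 := inord k in
  \matrix_(i, j)
    let p : 'I_n.+1 := inord i.-1 in
    if [&& (k < i)%N, (k <= j)%N & A p c != 0]
    then A i j - A i c / A p c * A p j else A i j.

Fixpoint neville (R : realType) (n : nat) (A : 'M[R]_n.+1) (k : nat) :
    'M[R]_n.+1 :=
  if k is k'.+1 then neville_step k' (neville A k') else A.

(* Meaningful for j < i. *)
Definition multiplier (R : realType) (n : nat) (A : 'M[R]_n.+1)
    (i j : 'I_n.+1) : R :=
  let B := neville A j in
  let p : 'I_n.+1 := inord i.-1 in
  if B p j == 0 then 0 else B i j / B p j.

Definition pivot (R : realType) (n : nat) (A : 'M[R]_n.+1) (i : 'I_n.+1) : R :=
  neville A i i i.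

Definition bd_F (R : realType) (n : nat) (A : 'M[R]_n.+1) (k : nat) :
    'M[R]_n.+1 :=
  \matrix_(i, j)
    if i == j then 1
    else if (i == j.+1 :> nat) && (k <= i)%N
         then multiplier A i (inord (i - k))
         else 0.

Definition bd_D (R : realType) (n : nat) (A : 'M[R]_n.+1) : 'M[R]_n.+1 :=
  diag_mx (\row_i pivot A i).

Definition bd_G (R : realType) (n : nat) (A : 'M[R]_n.+1) (k : nat) :
    'M[R]_n.+1 := (bd_F A^T k)^T.

(* The factors of F_n ... F_1 D G_1 ... G_n, numbered from 0 to 2n in their
   order in the product. *)
Definition bd_factor (R : realType) (n : nat) (A : 'M[R]_n.+1) (l : nat) :
    'M[R]_n.+1 :=
  if (l < n)%N then bd_F A (n - l)
  else if l == n then bd_D A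
  else bd_G A (l - n).

(** * Floating point arithmetic

  The standard model: each operation returns the exact result up to a relative
  error at most the unit round-off u. The exponent range is unbounded. With
  rounding to nearest in radix b and precision p, u = b^(1-p)/2 <= 1/2.
  Division by 0 and the square root of a negative number are unspecified. *)

Record fparith (R : realType) : Type := FPArith {
  roundoff : R;
  fl_add : R -> R -> R;
  fl_sub : R -> R -> R;
  fl_mul : R -> R -> R;
  fl_div : R -> R -> R;
  fl_sqrt : R -> R;
  roundoff_gt0 : 0 < roundoff;
  roundoff_le : roundoff <= 2^-1;
  fl_addP : forall x y,
    `|fl_add x y - (x + y)| <= roundoff * `|x + y|;
  fl_subP : forall x y,
    `|fl_sub x y - (x - y)| <= roundoff * `|x - y|;
  fl_mulP : forall x y,
    `|fl_mul x y - x * y| <= roundoff * `|x * y|;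
  fl_divP : forall x y, y != 0 ->
    `|fl_div x y - x / y| <= roundoff * `|x / y|;
  fl_sqrtP : forall x, 0 <= x ->
    `|fl_sqrt x - Num.sqrt x| <= roundoff * Num.sqrt x
}.

(** * Algorithms

  While-programs over real registers numbered by nat. The syntax carries no
  real number: the only constants are 0, 1 and the unit round-off of the
  arithmetic, which an iterative method needs for its stopping test. *)

Inductive fexpr : Type :=
| Reg of nat
| Zero
| One
| Roundoff
| Add of fexpr & fexpr
| Sub of fexpr & fexpr
| Mul of fexpr & fexpr
| Div of fexpr & fexpr
| Sqrt of fexpr.

Inductive fcmd : Type :=
| Skip
| Assign of nat & fexpr
| Seq of fcmd & fcmd
| IfLt of fexpr & fexpr & fcmd & fcmd
| WhileLt of fexpr & fexpr & fcmd.

Fixpoint feval (R : realType) (A : fparith R) (s : nat -> R) (e : fexpr) : R :=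
  match e with
  | Reg r => s r
  | Zero => 0
  | One => 1
  | Roundoff => roundoff A
  | Add e1 e2 => fl_add A (feval A s e1) (feval A s e2)
  | Sub e1 e2 => fl_sub A (feval A s e1) (feval A s e2)
  | Mul e1 e2 => fl_mul A (feval A s e1) (feval A s e2)
  | Div e1 e2 => fl_div A (feval A s e1) (feval A s e2)
  | Sqrt e1 => fl_sqrt A (feval A s e1)
  end.

Definition update (R : realType) (s : nat -> R) (r : nat) (x : R) : nat -> R :=
  fun r' => if r' == r then x else s r'.

(* [exec A c s s']: run in the arithmetic A from the store s, the program c
   halts in the store s'. The semantics is deterministic. *)
Inductive exec (R : realType) (A : fparith R) :
    fcmd -> (nat -> R) -> (nat -> R) -> Prop :=
| ExecSkip s : exec A Skip s s
| ExecAssign r e s : exec A (Assign r e) s (update s r (feval A s e))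
| ExecSeq c1 c2 s s1 s2 :
    exec A c1 s s1 -> exec A c2 s1 s2 -> exec A (Seq c1 c2) s s2
| ExecIfTrue e1 e2 c1 c2 s s' :
    feval A s e1 < feval A s e2 -> exec A c1 s s' ->
    exec A (IfLt e1 e2 c1 c2) s s'
| ExecIfFalse e1 e2 c1 c2 s s' :
    feval A s e2 <= feval A s e1 -> exec A c2 s s' ->
    exec A (IfLt e1 e2 c1 c2) s s'
| ExecWhileTrue e1 e2 c s s1 s2 :
    feval A s e1 < feval A s e2 -> exec A c s s1 ->
    exec A (WhileLt e1 e2 c) s1 s2 -> exec A (WhileLt e1 e2 c) s s2
| ExecWhileFalse e1 e2 c s :
    feval A s e2 <= feval A s e1 -> exec A (WhileLt e1 e2 c) s s.

(* The initial data fill the first registers, the others contain 0. *)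
Definition init_store (R : realType) (k : nat) (x : 'rV[R]_k) : nat -> R :=
  fun r => oapp (x 0) 0 (insub r : option 'I_k).

(** * High relative accuracy *)

(* A quantity equal to 0, such as an entry of a bidiagonal factor outside the
   two diagonals, has no relative error and must be computed exactly. *)
Definition rel_accurate (R : realType) (eps t t' : R) : Prop :=
  if t == 0 then t' = 0 else `|t - t'| / `|t| < eps.

(* From the initial data x in the domain P, the family y : O -> R determined by
   [spec x y] can be computed to high relative accuracy. The program, the output
   registers and K are chosen before the arithmetic and before the data: a K
   depending on x would only express that condition numbers are finite. *)
Definition HRA_computable (R : realType) (k : nat) (O : finType)
    (P : 'rV[R]_k -> Prop) (spec : 'rV[R]_k -> (O -> R) -> Prop) : Prop :=
  exists (c : fcmd) (out : O -> nat) (K : R), 0 < K /\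
    forall x : 'rV[R]_k, P x ->
      (exists y : O -> R, spec x y) /\
      forall y : O -> R, spec x y ->
      forall A : fparith R,
        exists2 s : nat -> R, exec A c (init_store x) s &
          forall o : O, rel_accurate (K * roundoff A) (y o) (s (out o)).

(** * Vandermonde matrices and the computed quantities *)

(* The library's [Vandermonde] has one column per node. *)
Definition vander (R : realType) (n : nat) (t : 'rV[R]_n.+1) : 'M[R]_n.+1 :=
  (Vandermonde n.+1 t)^T.

Definition sign_mx (R : realType) (n : nat) : 'M[R]_n.+1 :=
  diag_mx (\row_i (-1) ^+ i).

Definition vanderJ (R : realType) (n : nat) (t : 'rV[R]_n.+1) : 'M[R]_n.+1 :=
  vander t *m sign_mx R n.

Definition neg_decreasing (R : realType) (n : nat) (t : 'rV[R]_n.+1) : Prop :=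
  t 0 ord0 < 0 /\ forall i j : 'I_n.+1, (i < j)%N -> t 0 j < t 0 i.

Definition alternating (R : realType) (n : nat) (d : 'rV[R]_n) : Prop :=
  forall i j : 'I_n, j = i.+1 :> nat -> d 0 i * d 0 j < 0.

(* The square roots of the eigenvalues of A^T A, with multiplicity, in
   nonincreasing order. *)
Definition is_singular_values (R : realType) (n : nat) (A : 'M[R]_n)
    (sigma : 'I_n -> R) : Prop :=
  [/\ forall i, 0 <= sigma i,
      forall i j : 'I_n, (i <= j)%N -> sigma j <= sigma i &
      char_poly (A^T *m A) = \prod_i ('X - (sigma i ^+ 2)%:P)].

(* Main.v *)
Require Import Defs.
From mathcomp Require Import all_boot all_order all_algebra all_fingroup.
From mathcomp Require Import spectral sesquilinear complex.
From mathcomp Require Import reals zify ring lra.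

(** Put [s_i = - t_i], so that [V_J] is the Vandermonde matrix of the [s_i].
  For [0 < s_0 < ... < s_n] its minors are generalized Vandermonde determinants
  [det (s_i ^ a_j)]; eliminating the first node writes such a determinant as a
  product of node differences times a sum of smaller determinants with
  nonnegative coefficients. Hence the minors are positive, and all of them are
  obtained without subtractions other than those of initial data. Neville
  elimination of [V_J] produces divided differences of powers, and the entries
  of [V^-1] are the coefficients of the Lagrange polynomials, again without
  inaccurate cancellation.

  Singular values: let [B = V_J^T V_J], with eigenvalues [y_i^2]. The k-th
  compound matrix of [B] is nonnegative and known to high relative accuracy, and
  the trace of its [p]-th power is the [k]-th elementary symmetric function of
  the [y_i^(2p)]; so it lies between [L^p] and [2^(n+1) L^p], where
  [L = y_0^2 ... y_(k-1)^2]. Take [p = 2^q >= 1 / (2 u)] and compute the power by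
  [q] squarings: each doubles the relative error, but the [q] square roots that
  bring the trace back to [L] halve it again. The factor [2^(n+1)] becomes
  [2^((n+1)/p) = 1 + O(u)], and [y_k] is the square root of a quotient of two
  consecutive [L]. *)

Set Implicit Arguments.
Unset Strict Implicit.
Unset Printing Implicit Defensive.

Import Order.TTheory GRing.Theory Num.Theory.
Local Open Scope ring_scope.

(** * Minors and the Cauchy-Binet formula *)

(* The [i]-th smallest element of [S], or [ord0] if [i >= #|S|]. *)
Definition elt n k (S : {set 'I_n.+1}) (i : 'I_k) : 'I_n.+1 := nth ord0 (enum S) i.

Lemma sorted_enum_ord n (S : {set 'I_n.+1}) :
  sorted (fun i j : 'I_n.+1 => (i < j)%N) (enum S).
Proof.
rewrite {1}/enum_mem; apply: sorted_filter.
  by move=> x y z; apply: ltn_trans.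
rewrite -enumT; have := iota_ltn_sorted 0 n.+1; rewrite -val_enum_ord.
by rewrite sorted_map.
Qed.

Section Elt.
Variables (n k : nat) (S : {set 'I_n.+1}).
Hypothesis Sk : #|S| = k.

Let size_enum : size (enum S) = k. Proof. by rewrite -cardE. Qed.

Lemma elt_homo : {homo @elt n k S : i j / (i < j)%N}.
Proof.
move=> i j lt_ij; apply: (sorted_ltn_nth _ _ (sorted_enum_ord S)) => //.
- by move=> x y z; apply: ltn_trans.
- by rewrite inE size_enum.
- by rewrite inE size_enum.
Qed.

Lemma elt_inj : injective (@elt n k S).
Proof.
move=> i j /eqP; rewrite nth_uniq ?size_enum ?enum_uniq // => /eqP.
exact: val_inj.
Qed.

Lemma elt_mem (i : 'I_k) : elt S i \in S.
Proof. by rewrite -mem_enum mem_nth // size_enum. Qed.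

Lemma imset_elt : @elt n k S @: setT = S.
Proof.
apply/eqP; rewrite eqEcard; apply/andP; split.
  by apply/subsetP=> x /imsetP[i _ ->]; apply: elt_mem.
by rewrite card_imset ?cardsT ?card_ord ?Sk //; apply: elt_inj.
Qed.

Lemma prod_elt (R : comPzRingType) (F : 'I_n.+1 -> R) :
  \prod_(i < k) F (elt S i) = \prod_(i in S) F i.
Proof.
rewrite -[in RHS]imset_elt big_imset /=; last by move=> i j _ _; apply: elt_inj.
by apply: eq_bigl => i; rewrite inE.
Qed.

End Elt.

Section CauchyBinet.
Variable R : comNzRingType.

(** Multilinearity in the rows: [h i] records which row of [Q] is chosen in row [i] of the
    product. *)
Lemma det_mulmx_ffun k m (P : 'M[R]_(k, m)) (Q : 'M[R]_(m, k)) :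
  \det (P *m Q) =
  \sum_(h : {ffun 'I_k -> 'I_m}) (\prod_i P i (h i)) * \det (rowsub h Q).
Proof.
under [RHS]eq_bigr do rewrite /determinant big_distrr /=.
rewrite exchange_big /=; apply: eq_bigr => s _.
under eq_bigr do rewrite mxE.
rewrite bigA_distr_bigA big_distrr /=; apply: eq_bigr => h _.
rewrite big_split /= mulrCA; do 2 congr (_ * _).
by apply: eq_bigr => i _; rewrite mxE.
Qed.

Lemma det_rowsub_noninj k m (h : 'I_k -> 'I_m) (Q : 'M[R]_(m, k)) :
  ~ injective h -> \det (rowsub h Q) = 0.
Proof.
move/injectiveP/injectivePn => [i [j ij hij]].
by apply: (determinant_alternate ij) => l; rewrite !mxE hij.
Qed.

Lemma det_rowsub_perm k m (h : 'I_k -> 'I_m) (s : 'S_k) (Q : 'M[R]_(m, k)) :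
  \det (rowsub (h \o s) Q) = (-1) ^+ s * \det (rowsub h Q).
Proof.
rewrite -det_perm -det_mulmx -row_permE; congr (\det _).
by apply/matrixP => i j; rewrite !mxE.
Qed.

(** A non-injective [h] repeats a row and contributes 0. The injective ones are grouped by their
    image [U]: each is [elt U] after a permutation, and the signed sum over permutations is the
    minor of [P]. *)
Lemma cauchy_binet k n (P : 'M[R]_(k, n.+1)) (Q : 'M[R]_(n.+1, k)) :
  \det (P *m Q) = \sum_(U : {set 'I_n.+1} | #|U| == k)
    \det (colsub (elt U) P) * \det (rowsub (elt U) Q).
Proof.
rewrite det_mulmx_ffun (bigID (fun h : {ffun _ -> _} => injectiveb h)) /=.
rewrite addrC big1 ?add0r; last first.
  by move=> h /injectiveP hni; rewrite det_rowsub_noninj ?mulr0.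
rewrite (partition_big (fun h : {ffun 'I_k -> 'I_n.+1} => h @: setT)
   (fun U : {set 'I_n.+1} => #|U| == k)) /=; last first.
  by move=> h /injectiveP hi; rewrite card_imset // cardsT card_ord.
apply: eq_bigr => U /eqP Uk.
pose g (s : 'S_k) := [ffun i => elt U (s i)].
pose g' (h : {ffun 'I_k -> 'I_n.+1}) : 'S_k :=
  insubd (perm_one 'I_k) [ffun i => insubd i (index (h i) (enum U))].
have gK : forall s, g' (g s) = s.
  move=> s; have E : [ffun i => insubd i (index (g s i) (enum U))] = val s.
    apply/ffunP => i; rewrite !ffunE; apply: val_inj.
    have lt : index (elt U (s i)) (enum U) = s i.
      by rewrite /elt index_uniq ?enum_uniq // -cardE Uk.
    by rewrite lt valKd -pvalE.
  by apply: val_inj; rewrite /g' E valKd.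
rewrite (reindex_onto g g') /=; last first.
  move=> h /andP[/injectiveP hi /eqP hU].
  have hin i : h i \in enum U by rewrite mem_enum -hU imset_f.
  have lt i : (index (h i) (enum U) < k)%N.
    by rewrite -[X in (_ < X)%N]Uk cardE index_mem.
  have E : val (g' h) = [ffun i => insubd i (index (h i) (enum U))].
    rewrite insubdK // unfold_in; apply/injectiveP => i j.
    rewrite !ffunE => /(congr1 val); rewrite !val_insubd !lt => e.
    by apply: hi; rewrite -(nth_index ord0 (hin i)) e nth_index.
  apply/ffunP => i; rewrite ffunE /elt -[LHS]/(nth _ _ (g' h i)) -pvalE.
  by rewrite E ffunE val_insubd lt nth_index.
rewrite [X in _ = X * _]/determinant big_distrl /=; apply: eq_big => [s|s _].
  rewrite gK eqxx andbT; apply/andP; split.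
    by apply/injectiveP => i j; rewrite !ffunE => /(elt_inj Uk) /perm_inj.
  rewrite -[X in _ == X](imset_elt Uk); apply/eqP/setP => x.
  apply/imsetP/imsetP => [[i _ ->]|[i _ ->]].
    by exists (s i); rewrite ?ffunE.
  by exists (s^-1%g i); rewrite ?ffunE ?permKV.
have -> : rowsub (g s) Q = rowsub (elt U \o s) Q.
  by apply/matrixP => i j; rewrite !mxE ffunE.
rewrite det_rowsub_perm.
rewrite mulrCA mulrA; do 2 congr (_ * _).
by apply: eq_bigr => i _; rewrite !mxE ffunE.
Qed.

(* Meaningful for [#|S| = #|T| = k]; a separate [k] avoids casts between square
   matrices of sizes [#|S|] and [#|T|]. *)
Definition minor n k (S T : {set 'I_n.+1}) (A : 'M[R]_n.+1) : R :=
  \det (mxsub (elt S) (elt T) A : 'M_k).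

Lemma minorM n k (S T : {set 'I_n.+1}) (A B : 'M[R]_n.+1) :
  minor k S T (A *m B) =
  \sum_(U : {set 'I_n.+1} | #|U| == k) minor k S U A * minor k U T B.
Proof.
rewrite /minor mxsub_mul cauchy_binet; apply: eq_bigr => U _.
by congr (_ * _); congr (\det _); apply/matrixP => i j; rewrite !mxE.
Qed.

Lemma minor_tr n k (S T : {set 'I_n.+1}) (A : 'M[R]_n.+1) :
  minor k S T A^T = minor k T S A.
Proof. by rewrite /minor -det_tr; congr (\det _); apply/matrixP => i j; rewrite !mxE. Qed.

(** Both sides are traces of compound matrices, which Cauchy-Binet makes multiplicative. *)
Lemma trace_minorC n k (A B : 'M[R]_n.+1) :
  \sum_(S : {set 'I_n.+1} | #|S| == k) minor k S S (A *m B) =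
  \sum_(S : {set 'I_n.+1} | #|S| == k) minor k S S (B *m A).
Proof.
under eq_bigr do rewrite minorM; under [RHS]eq_bigr do rewrite minorM.
rewrite exchange_big /=; apply: eq_bigr => S _.
by apply: eq_bigr => T _; rewrite mulrC.
Qed.

Lemma minor_diag n k (S : {set 'I_n.+1}) (d : 'rV[R]_n.+1) :
  #|S| = k -> minor k S S (diag_mx d) = \prod_(i in S) d 0 i.
Proof.
move=> Sk; rewrite -(prod_elt Sk) /minor.
have -> : mxsub (elt S) (elt S) (diag_mx d) = diag_mx (\row_(i < k) d 0 (elt S i)).
  by apply/matrixP => i j; rewrite !mxE (inj_eq (elt_inj Sk)).
by rewrite det_diag; apply: eq_bigr => i _; rewrite mxE.
Qed.

End CauchyBinet.

(** * Generalized Vandermonde determinants *)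

Section GenVandermonde.
Variable R : comNzRingType.

Definition gvander k (x : 'I_k -> R) (a : 'I_k -> nat) : 'M[R]_k :=
  \matrix_(i, j) x i ^+ a j.

(** A geometric sum; as the range is a condition on ['I_M], the sums for different exponents share
    one index type and can be read as a matrix product. *)
Lemma subX_geom (x y : R) (a b M : nat) : (a <= b <= M)%N ->
  x ^+ b - y ^+ (b - a) * x ^+ a =
  (x - y) * \sum_(m < M | (a <= m < b)%N) y ^+ (b.-1 - m) * x ^+ m.
Proof.
move=> /andP[le_ab le_bM].
have -> : \sum_(m < M | (a <= m < b)%N) y ^+ (b.-1 - m) * x ^+ m =
          \sum_(a <= m < b) y ^+ (b.-1 - m) * x ^+ m.
  rewrite big_geq_mkord /= (big_ord_widen_cond M (fun m => (a <= m)%N)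
    (fun m => y ^+ (b.-1 - m) * x ^+ m)) //.
elim: b {M le_bM} le_ab => [|b IHb].
  by rewrite leqn0 => /eqP ->; rewrite big_geq // subnn mul1r subrr mulr0.
rewrite leq_eqVlt => /predU1P[-> | /[1!ltnS] le_ab].
  by rewrite big_geq // subnn mul1r subrr mulr0.
rewrite big_nat_recr //= subnn mul1r subSn // !exprS.
have -> : \sum_(a <= i < b) y ^+ (b - i) * x ^+ i =
          y * \sum_(a <= i < b) y ^+ (b.-1 - i) * x ^+ i.
  rewrite big_distrr; apply: eq_big_nat => i /andP[_ lt_ib] /=.
  by rewrite mulrA -exprS; congr (_ ^+ _ * _); lia.
by rewrite mulrDr mulrCA -IHb //; ring.
Qed.

(* Clear the first row by adding to each column a multiple of the previous one,
   then factor [x_i - x_0] out of every row; the sum runs over the exponents [m]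
   interlacing [a] (branching rule for Schur polynomials). *)
Lemma det_gvander_rec k (x : 'I_k.+1 -> R) (a : 'I_k.+1 -> nat) M :
  {homo a : i j / (i < j)%N} -> (forall j, a j <= M)%N ->
  \det (gvander x a) =
  x ord0 ^+ a ord0 * (\prod_(i < k) (x (lift ord0 i) - x ord0)) *
  \sum_(m : {ffun 'I_k -> 'I_M} |
        [forall j : 'I_k, a (widen_ord (leqnSn k) j) <= m j < a (lift ord0 j)]%N)
    (\prod_j x ord0 ^+ ((a (lift ord0 j)).-1 - m j)) *
    \det (gvander (fun i => x (lift ord0 i)) (fun j => m j)).
Proof.
move=> a_inc leM; set x0 := x ord0.
pose U : 'M[R]_k.+1 := \matrix_(l, j)
  ((l == j)%:R - (l.+1 == j :> nat)%:R * x0 ^+ (a j - a l)).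
have detU : \det U = 1.
  rewrite -det_tr det_trig.
    by apply: big1 => i _; rewrite !mxE eqxx [_.+1 == _]gtn_eqF // mul0r subr0.
  apply/is_trig_mxP => i j lt_ij; rewrite !mxE.
  by rewrite -val_eqE !gtn_eqF ?mul0r ?subr0 //; apply: ltnW.
pose Y : 'M[R]_(M, k) := \matrix_(m, j)
  if (a (widen_ord (leqnSn k) j) <= m < a (lift ord0 j))%N
  then x0 ^+ ((a (lift ord0 j)).-1 - m) else 0.
pose X : 'M[R]_(k, M) := \matrix_(i, m) x (lift ord0 i) ^+ m.
pose D : 'M[R]_k := diag_mx (\row_i (x (lift ord0 i) - x0)).
have AU0 i : (gvander x a *m U) i ord0 = x i ^+ a ord0.
  rewrite mxE (bigD1 ord0) //= !mxE mul0r subr0 mulr1 big1 ?addr0 // => l l0.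
  by rewrite !mxE (negPf l0) mul0r subr0 mulr0.
have AU i j : (gvander x a *m U) i (lift ord0 j) = x i ^+ a (lift ord0 j)
   - x0 ^+ (a (lift ord0 j) - a (widen_ord (leqnSn k) j)) *
     x i ^+ a (widen_ord (leqnSn k) j).
  rewrite mxE; under eq_bigr do rewrite !mxE mulrBr.
  rewrite sumrB; congr (_ - _).
    rewrite (bigD1 (lift ord0 j)) //= eqxx mulr1 big1 ?addr0 // => l lj.
    by rewrite (negPf lj) mulr0.
  rewrite (bigD1 (widen_ord (leqnSn k) j)) //= eqxx mul1r mulrC.
  rewrite big1 ?addr0 // => l; rewrite -val_eqE /= => lj.
  by rewrite /bump /= add1n eqSS (negPf lj) mul0r mulr0.
have E : row' ord0 (col' ord0 (gvander x a *m U)) = D *m (X *m Y).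
  apply/matrixP => i j; rewrite mul_diag_mx [LHS]mxE [LHS]mxE [RHS]mxE AU.
  rewrite (@subX_geom _ _ _ _ M); last by rewrite leM andbT ltnW // a_inc.
  rewrite !mxE; congr (_ * _); rewrite [LHS]big_mkcond /=.
  by apply: eq_bigr => m _; rewrite !mxE; case: ifP => _; rewrite ?mulr0 // mulrC.
rewrite -[LHS]mulr1 -[X in _ * X = _]detU -det_mulmx (expand_det_row _ ord0) big_ord_recl AU0.
rewrite big1 => [|j _]; last first.
  rewrite AU.
  by rewrite -exprD subnK ?subrr ?mul0r // ltnW // a_inc.
rewrite addr0 /cofactor E addn0 expr0 mul1r det_mulmx det_diag -mulrA.
congr (_ * (_ * _)); first by apply: eq_bigr => i _; rewrite mxE.
(* Expanding the transpose picks an exponent [m j] for each column [j] of [Y], whose entries vanish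
   unless [m] interlaces [a]. *)
rewrite -[LHS]det_tr trmx_mul det_mulmx_ffun [RHS]big_mkcond /=.
apply: eq_bigr => m _; case: ifPn => [/forallP m_in | ].
  congr (_ * _); last first.
    by rewrite -[RHS]det_tr; congr (\det _); apply/matrixP=> i j; rewrite !mxE.
  by apply: eq_bigr => j _; rewrite !mxE m_in.
case/forallPn=> j m_out.
by rewrite (bigD1 j) //= !mxE (negPf m_out) !mul0r.
Qed.

(** For [i < j] one has [m_i < a_(i+1) <= a_j <= m_j]. *)
Lemma gvander_interlace k (a : 'I_k.+1 -> nat) M (m : {ffun 'I_k -> 'I_M}) :
  {homo a : i j / (i < j)%N} ->
  [forall j : 'I_k, a (widen_ord (leqnSn k) j) <= m j < a (lift ord0 j)]%N ->
  {homo (fun j => m j : nat) : i j / (i < j)%N}.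
Proof.
move=> a_inc /forallP m_in i j lt_ij.
have /andP[_ lt_m] := m_in i; have /andP[le_m _] := m_in j.
apply: leq_trans lt_m (leq_trans _ le_m).
have : (lift ord0 i <= widen_ord (leqnSn k) j)%N by rewrite /= /bump /= add1n.
by rewrite leq_eqVlt => /predU1P[/val_inj-> // | /a_inc/ltnW].
Qed.

End GenVandermonde.

Lemma psumr_gt0 (R : realDomainType) (I : finType) (P : pred I) (F : I -> R) i :
  P i -> 0 < F i -> (forall j, P j -> 0 <= F j) -> 0 < \sum_(j | P j) F j.
Proof.
move=> Pi Fi F0; rewrite (bigD1 i) //=; apply: ltr_wpDr => //.
by apply: sumr_ge0 => j /andP[/F0].
Qed.

(** Induction on the order: the branching rule leaves a positive factor times a sum of positive
    terms, and it remains to see that this sum is not empty. *)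
Lemma det_gvander_gt0 (R : realDomainType) k (x : 'I_k -> R) (a : 'I_k -> nat) :
  (forall i, 0 < x i) -> {homo x : i j / (i < j)%N >-> i < j} ->
  {homo a : i j / (i < j)%N} -> 0 < \det (gvander x a).
Proof.
elim: k x a => [|k IHk] x a x_gt0 x_inc a_inc; first by rewrite det_mx00.
pose M := \max_j a j.
have leM j : (a j <= M)%N by apply: leq_bigmax.
rewrite (det_gvander_rec _ a_inc leM).
apply: mulr_gt0.
  apply: mulr_gt0; first exact: exprn_gt0.
  by apply: prodr_gt0 => i _; rewrite subr_gt0 x_inc.
have term_gt0 (m : {ffun 'I_k -> 'I_M}) :
  [forall j : 'I_k, a (widen_ord (leqnSn k) j) <= m j < a (lift ord0 j)]%N ->
  0 < (\prod_j x ord0 ^+ ((a (lift ord0 j)).-1 - m j)) *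
    \det (gvander (fun i => x (lift ord0 i)) (fun j => m j)).
  move=> m_in; apply: mulr_gt0; first by apply: prodr_gt0 => j _; apply: exprn_gt0.
  apply: IHk => // [i j lt_ij|]; last exact: gvander_interlace m_in.
  by apply: x_inc; rewrite /= /bump /= !add1n ltnS.
have lt_aM (j : 'I_k) : (a (widen_ord (leqnSn k) j) < M)%N.
  by apply: leq_trans (leM (lift ord0 j)); apply: a_inc.
(* The least interlacing exponents, [m_j = a_j]. *)
pose m0 : {ffun 'I_k -> 'I_M} := [ffun j => Ordinal (lt_aM j)].
have m0_in : [forall j : 'I_k, a (widen_ord (leqnSn k) j) <= m0 j < a (lift ord0 j)]%N.
  by apply/forallP => j; rewrite ffunE /= leqnn a_inc.
by apply: (psumr_gt0 m0_in) => [|m /term_gt0/ltW //]; apply: term_gt0.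
Qed.

(** * Strict total positivity of [vanderJ] *)

Section StrictTotalPositivity.
Variables (R : realType) (n : nat).
Implicit Type t : 'rV[R]_n.+1.

Lemma vanderJE t i j : vanderJ t i j = (- t 0 i) ^+ j.
Proof.
by rewrite /vanderJ /sign_mx mul_mx_diag !mxE mulrC -exprNn.
Qed.

Lemma vanderJ_sub t k (f g : 'I_k -> 'I_n.+1) :
  mxsub f g (vanderJ t) = gvander (fun i => - t 0 (f i)) (fun j => g j).
Proof. by apply/matrixP => i j; rewrite !mxE -vanderJE !mxE. Qed.

Lemma neg_decreasing_lt0 t i : neg_decreasing t -> t 0 i < 0.
Proof.
case=> t0 t_dec; have [->//|i0] := eqVneq i ord0.
by apply: lt_trans t0; apply: t_dec; rewrite lt0n.
Qed.

(** For the direct implication, the entry in row 0 and column 1 is [- t_0], and the minor of rows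
    [i < j] and columns 0, 1 is [t_i - t_j]; [0 < n] provides column 1. *)
Lemma vanderJ_STP t : (0 < n)%N -> STP (vanderJ t) <-> neg_decreasing t.
Proof.
move=> n_gt0; split=> [tSTP | t_nd k f g f_inc g_inc]; last first.
  rewrite vanderJ_sub; apply: det_gvander_gt0 => // [i | i j lt_ij].
    by rewrite oppr_gt0 neg_decreasing_lt0.
  by rewrite ltrN2; apply: (proj2 t_nd); apply: f_inc.
split=> [|i j lt_ij].
  have := tSTP 1 (fun=> ord0) (fun=> inord 1).
  rewrite vanderJ_sub det_mx11 mxE inordK ?ltnS // expr1 oppr_gt0; apply.
    by move=> i j; rewrite !ord1.
  by move=> i j; rewrite !ord1.
pose f (l : 'I_2) := if l == ord0 then i else j.
pose g (l : 'I_2) : 'I_n.+1 := inord l.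
have g_val l : g l = l :> nat by rewrite /g inordK // ltnS (leq_trans _ n_gt0) // -ltnS.
have := tSTP 2 f g; rewrite vanderJ_sub (expand_det_row _ ord0).
rewrite !big_ord_recl big_ord0 /cofactor !det_mx11 !mxE /f !g_val /=.
rewrite /bump /= !expr0 !expr1 !mul1r !mulr1 addr0 mulrN1 opprK addrC subr_gt0; apply.
  by case=> [[|[]]] // ? [[|[]]].
by move=> a b; rewrite !g_val.
Qed.

End StrictTotalPositivity.

(** * Relative errors *)

Section Acc.
Variable (R : realType).

(* Since [u <= 1/2], we have [1 - u >= (1 + 2 u)^-1]; a multiplicative error thus
   keeps signs and is stable under inversion, however coarse the arithmetic. *)
Definition acc (u : R) (m : nat) (x x' : R) : Prop :=
  exists2 d, x' = x * d & ((1 + u *+ 2) ^- m <= d <= (1 + u *+ 2) ^+ m).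

Variable u : R.
Hypotheses (u_gt0 : 0 < u) (u_le : u <= 2^-1).
Let rho := 1 + u *+ 2.

Let rho_ge1 : 1 <= rho. Proof. by rewrite /rho lerDl mulrn_wge0 // ltW. Qed.
Let rho_gt0 : 0 < rho. Proof. exact: lt_le_trans ltr01 rho_ge1. Qed.
Let rhoX_gt0 m : 0 < rho ^+ m. Proof. exact: exprn_gt0. Qed.
Let rhoV_gt0 m : 0 < rho ^- m. Proof. by rewrite invr_gt0. Qed.

Lemma acc_refl m x : acc u m x x.
Proof.
exists 1; first by rewrite mulr1.
by rewrite -/rho invf_le1 // exprn_ege1.
Qed.

Lemma acc_le m m' x x' : (m <= m')%N -> acc u m x x' -> acc u m' x x'.
Proof.
move=> le_m [d -> /andP[d1 d2]]; exists d => //; rewrite -/rho.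
rewrite (le_trans _ d1) ?(le_trans d2) -/rho //; first exact: ler_weXn2l.
by rewrite lef_pV2 ?posrE //; apply: ler_weXn2l.
Qed.

Lemma acc_trans m m' x y z : acc u m x y -> acc u m' y z -> acc u (m + m') x z.
Proof.
move=> [d -> /andP[d1 d2]] [e -> /andP[e1 e2]].
exists (d * e); rewrite ?mulrA // -/rho exprD invfM.
have d0 : 0 < d by apply: lt_le_trans d1.
have e0 : 0 < e by apply: lt_le_trans e1.
by rewrite !ler_pM // ltW.
Qed.

Lemma fl_acc x x' : `|x' - x| <= u * `|x| -> acc u 1 x x'.
Proof.
have [-> | x0] := eqVneq x 0.
  by rewrite subr0 normr0 mulr0 normr_le0 => /eqP ->; apply: acc_refl.
move=> le_x; exists (x' / x); first by rewrite mulrC divfK.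
have : `|x' / x - 1| <= u.
  have -> : x' / x - 1 = (x' - x) / x by rewrite mulrBl divff.
  by rewrite normf_div ler_pdivrMr // normr_gt0.
rewrite ler_norml -/rho expr1 => /andP[h1 h2]; apply/andP; split; last first.
  by rewrite /rho; move: u_gt0 => ?; lra.
(* Here [u <= 1/2] enters: [(1 - u) (1 + 2 u) = 1 + u (1 - 2 u) >= 1]. *)
apply: (@le_trans _ _ (1 - u)); last by lra.
rewrite -[_^-1]mul1r ler_pdivrMr // /rho.
by move: u_gt0 u_le => u0 u2; rewrite -subr_ge0; nra.
Qed.

Lemma acc_fl m x y z : acc u m x y -> `|z - y| <= u * `|y| -> acc u m.+1 x z.
Proof. by move=> xy /fl_acc yz; rewrite -addn1; apply: acc_trans yz. Qed.

Lemma acc_mul m m' x y x' y' : acc u m x x' -> acc u m' y y' ->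
  acc u (m + m') (x * y) (x' * y').
Proof.
move=> [d -> /andP[d1 d2]] [e -> /andP[e1 e2]].
have d0 : 0 < d by apply: lt_le_trans d1.
have e0 : 0 < e by apply: lt_le_trans e1.
exists (d * e); first by rewrite mulrACA.
by rewrite -/rho exprD invfM !ler_pM // ltW.
Qed.

Lemma acc_inv m x x' : acc u m x x' -> acc u m x^-1 x'^-1.
Proof.
move=> [d -> /andP[d1 d2]]; have d0 : 0 < d by apply: lt_le_trans d1.
exists d^-1; first by rewrite invfM.
rewrite -/rho lef_pV2 ?posrE // d2 /=.
by rewrite -[leRHS]invrK lef_pV2 ?posrE.
Qed.

Lemma acc_eq0 m x x' : acc u m x x' -> (x' == 0) = (x == 0).
Proof.
move=> [d -> /andP[d1 d2]]; have d0 : 0 < d by apply: lt_le_trans d1.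
by rewrite mulf_eq0 (gt_eqF d0) orbF.
Qed.

Lemma acc_ge0 m x x' : acc u m x x' -> 0 <= x -> 0 <= x'.
Proof.
move=> [d -> /andP[d1 d2]] x0; have d0 : 0 < d by apply: lt_le_trans d1.
by rewrite mulr_ge0 // ltW.
Qed.

Lemma acc_opp m x x' : acc u m x x' -> acc u m (- x) (- x').
Proof. by move=> [d -> h]; exists d; rewrite ?mulNr. Qed.

(** Without cancellation the error factor of the sum is a weighted mean of the two factors, so the
    exponent does not grow. *)
Lemma acc_add m x y x' y' : 0 <= x * y -> acc u m x x' -> acc u m y y' ->
  acc u m (x + y) (x' + y').
Proof.
have nneg a b a' b' : 0 <= a -> 0 <= b -> acc u m a a' -> acc u m b b' ->
    acc u m (a + b) (a' + b').
  move=> a0 b0 [d -> /andP[d1 d2]] [e -> /andP[e1 e2]].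
  have [ab0 | ab0] := eqVneq (a + b) 0.
    have /andP[/eqP -> /eqP ->] : (a == 0) && (b == 0) by rewrite -paddr_eq0 // ab0.
    by rewrite !mul0r addr0; apply: acc_refl.
  have ab_gt0 : 0 < a + b by rewrite lt_def ab0 addr_ge0.
  exists ((a * d + b * e) / (a + b)); first by rewrite [RHS]mulrC divfK.
  rewrite ler_pdivlMr // ler_pdivrMr //.
  rewrite ![_ * (a + b)]mulrC !mulrDl.
  by apply/andP; split; apply: lerD; apply: ler_wpM2l.
move=> xy accx accy; have [x0 | x0 | x0] := ltgtP x 0.
- rewrite nmulr_rge0 // in xy.
  rewrite -[x + y]opprK -[x' + y']opprK; apply: acc_opp; rewrite !opprD.
  by apply: nneg; rewrite ?oppr_ge0 ?(ltW x0) //; apply: acc_opp.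
- by rewrite pmulr_rge0 // in xy; apply: nneg => //; apply: ltW.
- have /eqP -> : x' == 0 by rewrite (acc_eq0 accx) x0.
  by rewrite x0 !add0r.
Qed.

Lemma acc_sqrt m x x' : 0 <= x -> acc u m.*2 x x' ->
  acc u m (Num.sqrt x) (Num.sqrt x').
Proof.
move=> x0 [d -> /andP[d1 d2]]; have d0 : 0 < d by apply: lt_le_trans d1.
exists (Num.sqrt d); first by rewrite sqrtrM.
move: d1 d2; rewrite -/rho -muln2 exprM => d1 d2.
have E : Num.sqrt ((rho ^+ m) ^+ 2) = rho ^+ m by rewrite sqrtr_sqr gtr0_norm.
by rewrite -E -sqrtrV ?sqr_ge0 // !ler_wsqrtr.
Qed.

(** Turns a power of [1 + 2 u] into a bound linear in [u]: as [1 + 2 u <= 2], induction gives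
    [(1 + 2 u)^m - 1 <= 2 u (2^m - 1)], with a constant free of [u]. *)
Lemma acc_rel m x x' : acc u m x x' -> rel_accurate (2 ^+ m.+1 * u) x x'.
Proof.
move=> [d -> /andP[d1 d2]]; rewrite /rel_accurate.
have [-> | x0] := eqVneq x 0; first by rewrite mul0r.
have -> : x - x * d = x * (1 - d) by rewrite mulrBr mulr1.
rewrite normrM mulrAC divff ?mul1r ?normr_eq0 //.
have le_rho : rho <= 2 by move: u_le; rewrite /rho; lra.
have rho_bound : rho ^+ m - 1 <= u * (2 * (2 ^+ m - 1)).
  elim: m {d1 d2} => [|m IHm]; first by rewrite !expr0 !subrr !mulr0.
  have -> : rho ^+ m.+1 - 1 = rho * (rho ^+ m - 1) + u *+ 2.
    by rewrite exprS /rho; ring.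
  apply: (@le_trans _ _ (2 * (u * (2 * (2 ^+ m - 1))) + u *+ 2)); last first.
    by rewrite le_eqVlt exprS; apply/orP; left; apply/eqP; ring.
  rewrite lerD2r; apply: ler_pM => //; first exact: ltW.
  by rewrite subr_ge0 exprn_ege1.
have lt_b : rho ^+ m - 1 < 2 ^+ m.+1 * u.
  apply: le_lt_trans rho_bound _; rewrite mulrC ltr_pM2r // exprS.
  by lra.
apply: le_lt_trans lt_b; rewrite ler_norml; apply/andP; split.
  by rewrite -/rho in d2; lra.
apply: (@le_trans _ _ (1 - rho ^- m)); first by rewrite -/rho in d1; lra.
have := ltW (rhoV_gt0 m); have := exprn_ege1 m rho_ge1.
have := mulfV (lt0r_neq0 (rhoX_gt0 m)).
set p := rho ^+ m; rewrite -/p; set q := p^-1 => pq p1 q0.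
nra.
Qed.

End Acc.

(** * Straight-line programs and loops *)

Fixpoint regs_below (B : nat) (e : fexpr) : bool :=
  match e with
  | Reg r => (r < B)%N
  | Zero | One | Roundoff => true
  | Add e1 e2 | Defs.Sub e1 e2 | Mul e1 e2 | Div e1 e2 =>
      regs_below B e1 && regs_below B e2
  | Sqrt e1 => regs_below B e1
  end.

Section Programs.
Variable R : realType.

Lemma feval_ext (A : fparith R) B e (s s' : nat -> R) : regs_below B e ->
  (forall r, (r < B)%N -> s r = s' r) -> feval A s e = feval A s' e.
Proof.
move=> e_lt ss'; elim: e e_lt => //=.
1-4: by move=> e1 IH1 e2 IH2 /andP[/IH1-> /IH2->].
by move=> e IH /IH->.
Qed.

Lemma regs_below_le B B' e : (B <= B')%N -> regs_below B e -> regs_below B' e.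
Proof.
move=> le_B; elim: e => //=; first by move=> r /leq_trans; apply.
all: by move=> e1 IH1 e2 IH2 /andP[/IH1-> /IH2->].
Qed.

Definition assigns (f : nat -> nat) (E : nat -> fexpr) (l : seq nat) : fcmd :=
  foldr (fun r c => Seq (Assign (f r) (E r)) c) Skip l.

(** The expressions depend on no register of [map f l], so each keeps its value in [s] however many
    assignments precede it. *)
Lemma exec_assigns (A : fparith R) f E l s : injective f ->
  (forall r s1 s2, r \in l -> (forall q, q \notin map f l -> s1 q = s2 q) ->
     feval A s1 (E r) = feval A s2 (E r)) ->
  exists s', [/\ exec A (assigns f E l) s s',
    forall r, r \in l -> s' (f r) = feval A s (E r) &
    forall q, q \notin map f l -> s' q = s q].
Proof.
move=> f_inj; set D := map f l => E_ext.
suff main l' : {subset l' <= l} -> exists s', [/\ exec A (assigns f E l') s s',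
    forall r, r \in l' -> s' (f r) = feval A s (E r) &
    forall q, q \notin map f l' -> s' q = s q] by exact: main.
elim: l' s => [|r l' IHl] s sub_l.
  by exists s; split => //; apply: ExecSkip.
have r_l : r \in l by apply: sub_l; rewrite mem_head.
pose s1 := update s (f r) (feval A s (E r)).
have ss1 r' : r' \in l -> feval A s1 (E r') = feval A s (E r').
  move=> r'_l; apply: E_ext => // q qD; rewrite /s1 /update.
  by case: eqP qD => // ->; rewrite map_f.
have [|s' [exec_s' s'_l s'_out]] := IHl s1.
  by move=> r' r'_l'; apply: sub_l; rewrite inE r'_l' orbT.
exists s'; split.
- by apply: ExecSeq exec_s'; apply: ExecAssign.
- move=> r' r'_l'; have [r'_l | r'_l] := boolP (r' \in l').
    by rewrite s'_l // ss1 // sub_l.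
  move: r'_l'; rewrite inE (negPf r'_l) orbF => /eqP er.
  by rewrite er s'_out /s1 /update ?eqxx // mem_map // -er.
- move=> q; rewrite /= inE negb_or => /andP[qr q_l].
  by rewrite s'_out // /s1 /update (negPf qr).
Qed.

(* Simultaneous assignment of the registers below [B], through the scratch
   registers [B, ..., 2 B - 1]. *)
Definition par (B : nat) (E : nat -> fexpr) : fcmd :=
  Seq (assigns (addn B) E (iota 0 B))
      (assigns id (fun r => Reg (B + r)) (iota 0 B)).

Lemma exec_par (A : fparith R) B E s :
  (forall r, (r < B)%N -> regs_below B (E r)) ->
  exists2 s', exec A (par B E) s s' &
    forall r, (r < B)%N -> s' r = feval A s (E r).
Proof.
move=> E_lt.
have [||s1 [exec1 s1_in _]] := @exec_assigns A (addn B) E (iota 0 B) s.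
- exact: addnI.
- move=> r s1 s2; rewrite mem_iota add0n => /E_lt/feval_ext h s12; apply: h.
  move=> q lt_qB; apply: s12; apply/mapP => -[p _ eq_q].
  by move: lt_qB; rewrite eq_q ltnNge leq_addr.
have [||s2 [exec2 s2_in _]] :=
  @exec_assigns A id (fun r => Reg (B + r)) (iota 0 B) s1.
- exact: inj_id.
- move=> r t1 t2 _ /= t12; apply: t12; rewrite map_id mem_iota add0n.
  by rewrite ltnNge leq_addr.
exists s2 => [|r lt_rB]; first exact: ExecSeq exec1 exec2.
have r_in : r \in iota 0 B by rewrite mem_iota.
by rewrite s2_in //= s1_in.
Qed.

Section State.
Variables (k : nat) (Q : finType).

(** Variables indexed by a finite type are stored right after the [k] input registers; [state_par]
    updates all of them at once and copies the inputs to themselves. *)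
Definition state_reg (q : Q) : nat := k + enum_rank q.

Definition state_par (e : Q -> fexpr) : fcmd :=
  par (k + #|Q|) (fun r => if (r < k)%N then Reg r
    else oapp (fun i : 'I_#|Q| => e (enum_val i)) Zero (insub (r - k)%N)).

Lemma state_reg_lt q : (state_reg q < k + #|Q|)%N.
Proof. by rewrite ltn_add2l. Qed.

Lemma exec_state_par (A : fparith R) e s :
  (forall q, regs_below (k + #|Q|) (e q)) ->
  exists2 s', exec A (state_par e) s s' &
    forall q, s' (state_reg q) = feval A s (e q).
Proof.
move=> e_lt.
have [|s' exec_s' s'_E] := @exec_par A (k + #|Q|)
    (fun r => if (r < k)%N then Reg r
    else oapp (fun i : 'I_#|Q| => e (enum_val i)) Zero (insub (r - k)%N)) s.
  move=> r lt_r; case: ifP => [lt_rk|_] //=.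
  by case: insubP => [i _ _|_] //=; apply: e_lt.
exists s' => // q; rewrite s'_E ?state_reg_lt // /state_reg.
by rewrite ltnNge leq_addr /= addKn valK /= enum_rankK.
Qed.

End State.

(** The number [q] of steps does not occur in the program: the guard determines it, holding under
    [Inv j] for [j < q] and failing under [Inv q]. Induction on the number [d] of remaining
    steps. *)
Lemma exec_loop (A : fparith R) e1 e2 c (q : nat)
    (Inv : nat -> (nat -> R) -> Prop) s :
  (forall j s, (j < q)%N -> Inv j s ->
     feval A s e1 < feval A s e2 /\ exists2 s', exec A c s s' & Inv j.+1 s') ->
  (forall s, Inv q s -> feval A s e2 <= feval A s e1) ->
  Inv 0 s -> exists2 s', exec A (WhileLt e1 e2 c) s s' & Inv q s'.
Proof.
move=> step stop.
suff main d : (d <= q)%N -> forall s, Inv (q - d)%N s ->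
    exists2 s', exec A (WhileLt e1 e2 c) s s' & Inv q s'.
  by move=> inv0; apply: (main q) => //; rewrite subnn.
elim: d => [_ {}s|d IHd lt_d {}s inv_s].
  by rewrite subn0 => inv_q; exists s => //; apply: ExecWhileFalse; apply: stop.
have [|lt_e [s1 exec1]] := step _ _ _ inv_s; first by lia.
rewrite -subSn // subSS => /(IHd (ltnW lt_d))[s' exec' inv'].
by exists s' => //; apply: ExecWhileTrue exec1 exec'.
Qed.

End Programs.

(** * Quantities evaluated without inaccurate cancellation *)

Section HExpr.
Variables (R : realType) (k : nat) (P : 'rV[R]_k -> Prop).

(** The expression and the exponent [m] come before the arithmetic and the data, since one [K] must
    serve for all of them. The closure lemmas below are the rules of no inaccurate cancellation. *)
Definition hexpr (F : 'rV[R]_k -> R) : Prop := exists e m, regs_below k e /\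
  forall (A : fparith R) x, P x ->
    acc (roundoff A) m (F x) (feval A (init_store x) e).

Lemma hexpr_ext F G : (forall x, P x -> F x = G x) -> hexpr F -> hexpr G.
Proof.
by move=> FG [e [m [e_lt eP]]]; exists e, m; split=> // A x Px; rewrite -FG //; apply: eP.
Qed.

Lemma init_storeE (x : 'rV[R]_k) (i : 'I_k) : init_store x i = x 0 i.
Proof. by rewrite /init_store valK. Qed.

Let u_gt0 (A : fparith R) := roundoff_gt0 A.
Let u_le (A : fparith R) := roundoff_le A.
Hint Resolve u_gt0 u_le : core.

Lemma hexpr0 : hexpr (fun=> 0).
Proof. by exists Zero, 0; split=> // A x _; apply: acc_refl. Qed.

Lemma hexpr1 : hexpr (fun=> 1).
Proof. by exists One, 0; split=> // A x _; apply: acc_refl. Qed.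

Lemma hexpr_reg i : hexpr (fun x => x 0 i).
Proof.
exists (Reg i), 0; split; first by rewrite /= ltn_ord.
by move=> A x _ /=; rewrite init_storeE; apply: acc_refl.
Qed.

(** Initial data are stored exactly, so their difference suffers a single rounding whatever the
    cancellation. *)
Lemma hexpr_subreg i j : hexpr (fun x => x 0 i - x 0 j).
Proof.
exists (Defs.Sub (Reg i) (Reg j)), 1; split; first by rewrite /= !ltn_ord.
by move=> A x _ /=; rewrite !init_storeE; apply: fl_acc => //; apply: fl_subP.
Qed.

Lemma hexpr_opp F : hexpr F -> hexpr (fun x => - F x).
Proof.
move=> [e [m [e_lt eP]]]; exists (Defs.Sub Zero e), m.+1; split=> // A x Px /=.
apply: acc_fl (fl_subP _ _ _) => //.
by rewrite sub0r; apply: acc_opp; apply: eP.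
Qed.

Lemma hexpr_mul F G : hexpr F -> hexpr G -> hexpr (fun x => F x * G x).
Proof.
move=> [e [m [e_lt eP]]] [e' [m' [e'_lt e'P]]].
exists (Mul e e'), (m + m').+1; split; first by rewrite /= e_lt.
move=> A x Px /=; apply: acc_fl (fl_mulP _ _ _) => //.
by apply: acc_mul => //; [apply: eP|apply: e'P].
Qed.

Lemma hexpr_div F G : (forall x, P x -> G x != 0) ->
  hexpr F -> hexpr G -> hexpr (fun x => F x / G x).
Proof.
move=> G0 [e [m [e_lt eP]]] [e' [m' [e'_lt e'P]]].
exists (Div e e'), (m + m').+1; split; first by rewrite /= e_lt.
move=> A x Px /=; have acc' := e'P A x Px.
apply: acc_fl (fl_divP _ _ _) => //; last by rewrite (acc_eq0 _ acc') // G0.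
by apply: acc_mul => //; [apply: eP|apply: acc_inv].
Qed.

Lemma hexpr_add F G : (forall x, P x -> 0 <= F x * G x) ->
  hexpr F -> hexpr G -> hexpr (fun x => F x + G x).
Proof.
move=> FG0 [e [m [e_lt eP]]] [e' [m' [e'_lt e'P]]].
exists (Add e e'), (maxn m m').+1; split; first by rewrite /= e_lt.
move=> A x Px /=; apply: acc_fl (fl_addP _ _ _) => //; apply: acc_add => //.
- exact: FG0.
- by apply: acc_le (eP A x Px); rewrite ?leq_maxl.
- by apply: acc_le (e'P A x Px); rewrite ?leq_maxr.
Qed.

Lemma hexpr_prod I (r : seq I) (F : I -> 'rV[R]_k -> R) :
  (forall i, hexpr (F i)) -> hexpr (fun x => \prod_(i <- r) F i x).
Proof.
move=> hF; elim: r => [|i r IHr].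
  by apply: hexpr_ext hexpr1 => x _; rewrite big_nil.
by apply: hexpr_ext (hexpr_mul (hF i) IHr) => x _; rewrite big_cons.
Qed.

Lemma hexpr_exp F m : hexpr F -> hexpr (fun x => F x ^+ m).
Proof.
move=> hF; have := hexpr_prod (index_enum 'I_m) (fun=> hF).
by apply: hexpr_ext => x _; rewrite prodr_const card_ord.
Qed.

(** [sg] carries the common sign of the terms, which may depend on the data; each term then has a
    nonnegative product with the sum of the later ones. *)
Lemma hexpr_sum_sign I (r : seq I) (D : pred I) (F : I -> 'rV[R]_k -> R)
    (sg : 'rV[R]_k -> R) :
  (forall x, P x -> sg x != 0) ->
  (forall i x, D i -> P x -> 0 <= sg x * F i x) ->
  (forall i, D i -> hexpr (F i)) -> hexpr (fun x => \sum_(i <- r | D i) F i x).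
Proof.
move=> sg0 sgF hF; elim: r => [|i r IHr].
  by apply: hexpr_ext hexpr0 => x _; rewrite big_nil.
have [Di|Di] := boolP (D i); last first.
  by apply: hexpr_ext IHr => x _; rewrite big_cons (negPf Di).
apply: hexpr_ext (hexpr_add _ (hF i Di) IHr) => x Px.
  by rewrite big_cons Di.
have sum_ge0 : 0 <= sg x * \sum_(j <- r | D j) F j x.
  by rewrite big_distrr /=; apply: sumr_ge0 => j Dj; apply: sgF.
rewrite -(pmulr_rge0 _ (_ : 0 < sg x ^+ 2)); last by rewrite exprn_even_gt0 ?sg0.
have -> : sg x ^+ 2 * (F i x * \sum_(j <- r | D j) F j x) =
  (sg x * F i x) * (sg x * \sum_(j <- r | D j) F j x) by ring.
by rewrite mulr_ge0 // sgF.
Qed.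

Lemma hexpr_sum I (r : seq I) (D : pred I) (F : I -> 'rV[R]_k -> R) :
  (forall i x, D i -> P x -> 0 <= F i x) ->
  (forall i, D i -> hexpr (F i)) -> hexpr (fun x => \sum_(i <- r | D i) F i x).
Proof.
move=> F0; apply: (@hexpr_sum_sign _ _ _ _ (fun=> 1)) => [x _|i x Di Px].
  exact: oner_neq0.
by rewrite mul1r F0.
Qed.

Lemma hexpr_family (O : finType) (F : O -> 'rV[R]_k -> R) :
  (forall o, hexpr (F o)) ->
  exists e m, (forall o, regs_below k (e o)) /\
    forall o (A : fparith R) x, P x ->
      acc (roundoff A) m (F o x) (feval A (init_store x) (e o)).
Proof.
move=> /fin_all_exists[e /fin_all_exists[m em]].
exists e, (\max_o m o); split=> [o|o A x Px]; first by case: (em o).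
have [_ /(_ A x Px)] := em o; apply: acc_le => //.
exact: leq_bigmax.
Qed.

(** One parallel assignment evaluates the family. [spec] may be implicit, provided that it
    determines the values [F o x]. *)
Lemma hexpr_HRA (O : finType) (F : O -> 'rV[R]_k -> R)
    (spec : 'rV[R]_k -> (O -> R) -> Prop) :
  (forall o, hexpr (F o)) ->
  (forall x, P x -> spec x (fun o => F o x)) ->
  (forall x y, P x -> spec x y -> forall o, y o = F o x) ->
  HRA_computable P spec.
Proof.
move=> /hexpr_family[e [m [e_lt eP]]] specF spec_uniq.
exists (state_par k e), (@state_reg k O), (2 ^+ m.+1); split.
  by rewrite exprn_gt0.
move=> x Px; split=> [|y /(spec_uniq x y Px) yF A]; first by exists (F^~ x); apply: specF.
have [|s exec_s s_e] := @exec_state_par R k O A e (init_store x).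
  by move=> o; apply: regs_below_le (e_lt o); rewrite leq_addr.
exists s => // o; rewrite s_e yF; apply: acc_rel => //; exact: eP.
Qed.

End HExpr.

(** * Bidiagonal decomposition *)

Section DividedDifferences.
Variables (R : fieldType) (x : nat -> R) (n : nat).
Hypothesis x_inj : forall i j, (j < i <= n)%N -> x i - x j != 0.

(** For [k <= i], the divided difference of [X^j] at the nodes [x_(i-k), ..., x_i]. *)
Fixpoint divdiff (k i j : nat) : R :=
  if k is k'.+1 then (divdiff k' i j - divdiff k' i.-1 j) / (x i - x (i - k)%N)
  else x i ^+ j.

Lemma divdiffSE k i j : (k < i <= n)%N ->
  divdiff k i j - divdiff k i.-1 j = (x i - x (i - k.+1)%N) * divdiff k.+1 i j.
Proof. by move=> lt_i /=; rewrite mulrC divfK // x_inj //; lia. Qed.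

(** Leibniz rule for [X * X^j]: of the divided differences of [X] only those of orders 0 and 1,
    namely [x_i] and 1, survive. *)
Lemma divdiff_Xmul k i j : (k <= i <= n)%N -> divdiff k i j.+1 =
  x i * divdiff k i j + (if k is k'.+1 then divdiff k' i.-1 j else 0).
Proof.
elim: k i => [|k IHk] i lt_i; first by rewrite addr0 /= exprS.
have ne0 : x i - x (i - k.+1)%N != 0 by apply: x_inj; lia.
apply: (mulfI ne0); rewrite -divdiffSE; last by lia.
rewrite mulrDr mulrCA -divdiffSE; last by lia.
rewrite !IHk; [|lia|lia].
case: k lt_i {IHk ne0} => [|k] lt_i.
  by rewrite subn1; ring.
have -> : (i - k.+2 = i.-1 - k.+1)%N by lia.
transitivity (x i * divdiff k.+1 i j - x i.-1 * divdiff k.+1 i.-1 j +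
  (x i.-1 - x (i.-1 - k.+1)%N) * divdiff k.+1 i.-1 j); last by ring.
by rewrite -divdiffSE; [ring|lia].
Qed.

(** A divided difference of order [k] annihilates polynomials of degree below [k] and is the leading
    coefficient in degree [k]. *)
Lemma divdiff_low k i j : (k <= i <= n)%N -> (j <= k)%N ->
  divdiff k i j = (j == k)%:R.
Proof.
elim: j k i => [|j IHj] k i lt_i.
  elim: k i lt_i => [|k IHk] i lt_i _; first by rewrite eqxx.
  rewrite /= !IHk //; [|lia|lia].
  by rewrite subrr mul0r.
case: k lt_i => // k lt_i; rewrite ltnS => le_jk.
rewrite divdiff_Xmul // !IHj //; [|lia|lia].
by rewrite eqSS [j == k.+1]ltn_eqF // mulr0 add0r.
Qed.

End DividedDifferences.

(** * Neville elimination of a Vandermonde matrix and of its transpose *)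

Section Neville.
Variables (R : realType) (n : nat) (x : nat -> R) (A : 'M[R]_n.+1).
Hypothesis x_inj : forall i j, (j < i <= n)%N -> x i - x j != 0.
Hypothesis A_E : forall i j, A i j = x i ^+ j.

(** The Newton polynomial whose roots are the [k] nodes before [x_i], evaluated at [x_i]; it scales
    row [i] of the eliminated matrix. *)
Definition back_prod (k i : nat) : R := \prod_(l < k) (x i - x (i - l.+1)%N).

Lemma back_prod_neq0 k i : (k <= i <= n)%N -> back_prod k i != 0.
Proof.
move=> le_k; apply/prodf_neq0 => l _; apply: x_inj.
by have := ltn_ord l; lia.
Qed.

Lemma back_prodS k i : back_prod k.+1 i = back_prod k i * (x i - x (i - k.+1)%N).
Proof. by rewrite /back_prod big_ord_recr. Qed.

(** Row [i] changes only during the first [i] steps, hence [minn i k]. In the pivot column the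
    divided differences equal 1, so the multiplier is a quotient of two [back_prod] and the step
    becomes the recurrence of [divdiff]. *)
Lemma neville_vander k (i j : 'I_n.+1) : (k <= n)%N ->
  neville A k i j = back_prod (minn i k) i * divdiff x (minn i k) i j.
Proof.
elim: k i j => [|k IHk] i j lt_kn /=.
  by rewrite minn0 /back_prod big_ord0 mul1r /= A_E.
have le_kn := ltnW lt_kn.
rewrite mxE; cbv zeta; rewrite !IHk //; have [lt_ki | le_ik] := ltnP k i; last first.
  by rewrite (minn_idPl (leqW le_ik)).
have lt_in := ltn_ord i.
have p_val : (inord i.-1 : 'I_n.+1) = i.-1 :> nat by rewrite inordK //; lia.
have k_val : (inord k : 'I_n.+1) = k :> nat by rewrite inordK //; lia.
rewrite !p_val !k_val (minn_idPr lt_ki).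
have -> : minn i.-1 k = k by lia.
rewrite (@divdiff_low _ _ n _ k i.-1 k) ?(@divdiff_low _ _ n _ k i k) //; [|lia|lia].
rewrite eqxx !mulr1 back_prod_neq0 ?andbT ?andTb; last by lia.
have [le_kj | lt_jk] := leqP k j.
  rewrite back_prodS -[RHS]mulrA -(divdiffSE x_inj); last by lia.
  rewrite mulrBr; congr (_ - _); rewrite mulrA divfK //.
  by apply: back_prod_neq0; lia.
(* Left of column [k] the order exceeds the degree [j], and both sides vanish. *)
rewrite !(@divdiff_low _ _ n _) //; [|lia|lia|lia|lia].
by rewrite !ltn_eqF ?mulr0 //; lia.
Qed.

Lemma multiplier_vander (i j : 'I_n.+1) : (j < i)%N ->
  multiplier A i j = back_prod j i / back_prod j i.-1.
Proof.
move=> lt_ji; have lt_in := ltn_ord i.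
rewrite /multiplier !neville_vander; [|lia|lia].
have -> : (inord i.-1 : 'I_n.+1) = i.-1 :> nat by rewrite inordK //; lia.
have -> : minn i.-1 j = j by lia.
have -> : minn i j = j by lia.
rewrite !(@divdiff_low _ _ n _) //; [|lia|lia].
by rewrite eqxx !mulr1 (negPf (back_prod_neq0 _)) //; lia.
Qed.

Lemma pivot_vander (i : 'I_n.+1) : pivot A i = back_prod i i.
Proof.
have lt_in := ltn_ord i.
rewrite /pivot neville_vander ?minnn; last by lia.
by rewrite (@divdiff_low _ _ n _) ?eqxx ?mulr1 //; lia.
Qed.

Hypothesis x_neq0 : forall i, (i <= n)%N -> x i != 0.

(** Step [k] subtracts [x_k] times the previous row from each row below row [k]; in column [j] this
    trades one factor [x_j] for [x_j - x_k]. *)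
Lemma neville_vander_tr k (i j : 'I_n.+1) : (k <= n)%N ->
  neville A^T k i j =
  x j ^+ (i - minn i k) * \prod_(l < minn i k) (x j - x l).
Proof.
elim: k i j => [|k IHk] i j lt_kn /=.
  by rewrite minn0 big_ord0 mulr1 subn0 mxE A_E.
have le_kn := ltnW lt_kn.
rewrite mxE; cbv zeta; rewrite !IHk //; have [lt_ki | le_ik] := ltnP k i; last first.
  by rewrite (minn_idPl (leqW le_ik)).
have lt_in := ltn_ord i.
have p_val : (inord i.-1 : 'I_n.+1) = i.-1 :> nat by rewrite inordK //; lia.
have k_val : (inord k : 'I_n.+1) = k :> nat by rewrite inordK //; lia.
rewrite !p_val !k_val (minn_idPr lt_ki).
have -> : minn i.-1 k = k by lia.
have -> : (i - k = (i.-1 - k).+1)%N by lia.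
have -> : (i - k.+1 = i.-1 - k)%N by lia.
set Qk := \prod_(l < k) (x k - x l).
have xk_neq0 : x k ^+ (i.-1 - k) * Qk != 0.
  rewrite mulf_neq0 ?expf_neq0 ?x_neq0 //.
  by apply/prodf_neq0 => l _; apply: x_inj; have := ltn_ord l; lia.
rewrite xk_neq0 andbT big_ord_recr /=; case: leqP => [le_kj | lt_jk].
  have -> : x k ^+ (i.-1 - k).+1 * Qk / (x k ^+ (i.-1 - k) * Qk) = x k.
    by rewrite exprS -[x k * _ * _]mulrA mulfK.
  by rewrite exprS; ring.
have -> : \prod_(l < k) (x j - x l) = 0.
  by apply/eqP/prodf_eq0; exists (Ordinal lt_jk) => //=; rewrite subrr.
by rewrite mul0r !mulr0.
Qed.

Lemma multiplier_vander_tr (i j : 'I_n.+1) : (j < i)%N ->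
  multiplier A^T i j = x j.
Proof.
move=> lt_ji; have lt_in := ltn_ord i.
rewrite /multiplier !neville_vander_tr; [|lia|lia].
have -> : (inord i.-1 : 'I_n.+1) = i.-1 :> nat by rewrite inordK //; lia.
have -> : minn i.-1 j = j by lia.
have -> : minn i j = j by lia.
have -> : (i - j = (i.-1 - j).+1)%N by lia.
have ne0 : x j ^+ (i.-1 - j) * \prod_(l < j) (x j - x l) != 0.
  apply: mulf_neq0; first by apply/expf_neq0/x_neq0; lia.
  by apply/prodf_neq0 => l _; apply: x_inj; have := ltn_ord l; lia.
by rewrite (negPf ne0) exprS -[x j * _ * _]mulrA mulfK.
Qed.

End Neville.

(** * Accurate multipliers, pivots and bidiagonal factors *)

Section BidiagonalHRA.
Variables (R : realType) (n : nat).

Let nodes (t : 'rV[R]_n.+1) (i : nat) : R := - t 0 (inord i).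

Let nodes_inj t : neg_decreasing t ->
  forall i j, (j < i <= n)%N -> nodes t i - nodes t j != 0.
Proof.
move=> [_ t_dec] i j lt_ji; rewrite /nodes opprK addrC subr_eq0 gt_eqF //.
by apply: t_dec; rewrite !inordK; lia.
Qed.

Let nodes_neq0 t : neg_decreasing t -> forall i, (i <= n)%N -> nodes t i != 0.
Proof. by move=> t_nd i _; rewrite oppr_eq0 lt_eqF // neg_decreasing_lt0. Qed.

Let nodesE (t : 'rV[R]_n.+1) (i j : 'I_n.+1) : vanderJ t i j = nodes t i ^+ j.
Proof. by rewrite vanderJE /nodes inord_val. Qed.

Let hexpr_back_prod k i : hexpr (@neg_decreasing R n) (fun t => back_prod (nodes t) k i).
Proof.
apply: hexpr_prod => l.
apply: hexpr_ext (hexpr_subreg _ (inord (i - l.+1)) (inord i)) => t _.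
by rewrite /nodes opprK addrC.
Qed.

Lemma hexpr_multiplier (i j : 'I_n.+1) : (j < i)%N ->
  hexpr (@neg_decreasing R n) (fun t => multiplier (vanderJ t) i j).
Proof.
move=> lt_ji; have lt_in := ltn_ord i.
apply: hexpr_ext (hexpr_div _ (hexpr_back_prod j i) (hexpr_back_prod j i.-1)).
  by move=> t t_nd; rewrite (multiplier_vander (nodes_inj t_nd) (nodesE t)).
by move=> t t_nd; apply: (back_prod_neq0 (nodes_inj t_nd)); lia.
Qed.

Lemma hexpr_multiplier_tr (i j : 'I_n.+1) : (j < i)%N ->
  hexpr (@neg_decreasing R n) (fun t => multiplier (vanderJ t)^T i j).
Proof.
move=> lt_ji; apply: hexpr_ext (hexpr_opp (hexpr_reg _ j)) => t t_nd.
rewrite (multiplier_vander_tr (nodes_inj t_nd) (nodesE t) (nodes_neq0 t_nd)) //.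
by rewrite /nodes inord_val.
Qed.

Lemma hexpr_pivot (i : 'I_n.+1) :
  hexpr (@neg_decreasing R n) (fun t => pivot (vanderJ t) i).
Proof.
apply: hexpr_ext (hexpr_back_prod i i) => t t_nd.
by rewrite (pivot_vander (nodes_inj t_nd) (nodesE t)).
Qed.

Lemma hexpr_bd_F (M : 'rV[R]_n.+1 -> 'M[R]_n.+1) k (i j : 'I_n.+1) : (0 < k)%N ->
  (forall i j : 'I_n.+1, (j < i)%N ->
     hexpr (@neg_decreasing R n) (fun t => multiplier (M t) i j)) ->
  hexpr (@neg_decreasing R n) (fun t => bd_F (M t) k i j).
Proof.
move=> k_gt0 hM.
have E (t : 'rV[R]_n.+1) : bd_F (M t) k i j = if i == j then 1
    else if (i == j.+1 :> nat) && (k <= i)%N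
         then multiplier (M t) i (inord (i - k)) else 0 by rewrite mxE.
apply: (@hexpr_ext _ _ _ _ _ (fun t _ => esym (E t))).
have [_|_] := eqVneq i j; first exact: hexpr1.
have [/andP[_ le_ki]|_] := boolP (_ && _); last exact: hexpr0.
by have lt_in := ltn_ord i; apply: hM; rewrite inordK; lia.
Qed.

Lemma hexpr_bd_factor l (i j : 'I_n.+1) :
  hexpr (@neg_decreasing R n) (fun t => bd_factor (vanderJ t) l i j).
Proof.
rewrite /bd_factor; case: ltnP => [lt_ln | le_nl].
  by apply: hexpr_bd_F; [lia | exact: hexpr_multiplier].
have [_ | ne_ln] := eqVneq l n.
  have E (t : 'rV[R]_n.+1) : bd_D (vanderJ t) i j = if i == j then pivot (vanderJ t) i else 0.
    by rewrite !mxE; case: eqP => // _; rewrite mulr0n.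
  apply: (@hexpr_ext _ _ _ _ _ (fun t _ => esym (E t))).
  by have [_|_] := eqVneq i j; [apply: hexpr_pivot | apply: hexpr0].
have E (t : 'rV[R]_n.+1) : bd_G (vanderJ t) (l - n) i j = bd_F (vanderJ t)^T (l - n) j i.
  by rewrite mxE.
apply: (@hexpr_ext _ _ _ _ _ (fun t _ => esym (E t))).
by apply: (@hexpr_bd_F (fun t => (vanderJ t)^T)); [lia | exact: hexpr_multiplier_tr].
Qed.

Lemma bidiagonal_HRA : HRA_computable (O := ('I_(n.*2.+1) * 'I_n.+1 * 'I_n.+1)%type)
  (fun t : 'rV[R]_n.+1 => neg_decreasing t)
  (fun t y => forall (l : 'I_(n.*2.+1)) (i j : 'I_n.+1),
     y (l, i, j) = bd_factor (vanderJ t) l i j).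
Proof.
apply: (@hexpr_HRA R n.+1 _ ('I_(n.*2.+1) * 'I_n.+1 * 'I_n.+1)%type
  (fun o t => bd_factor (vanderJ t) o.1.1 o.1.2 o.2)).
- by case=> -[l i] j; apply: hexpr_bd_factor.
- by [].
- by move=> t y _ spec [[l i] j]; apply: spec.
Qed.

End BidiagonalHRA.

(** * Inverse and linear systems *)

Section Lagrange.
Variables (R : realType) (n : nat).
Implicit Type t : 'rV[R]_n.+1.

Definition lagr_num t (j : 'I_n.+1) : {poly R} :=
  \prod_(k | k != j) ('X - (t 0 k)%:P).

Definition lagr_den t (j : 'I_n.+1) : R := \prod_(k | k != j) (t 0 j - t 0 k).

Lemma horner_lagr_num t j i :
  (lagr_num t j).[t 0 i] = if i == j then lagr_den t j else 0.
Proof.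
rewrite horner_prod; under eq_bigr do rewrite hornerXsubC.
case: eqVneq => [-> //|ne_ij].
by rewrite (bigD1 i) //= subrr mul0r.
Qed.

Lemma size_lagr_num t j : (size (lagr_num t j) <= n.+1)%N.
Proof.
rewrite /lagr_num -big_filter size_prod_XsubC.
have : #|predC1 j| = n by rewrite cardC1 card_ord.
by rewrite cardE /enum_mem !size_filter ltnS => En; rewrite -[X in (_ <= X)%N]En.
Qed.

(** Exactly the [j] factors with [k < j] are negative, because the nodes decrease. *)
Lemma lagr_den_sign t (j : 'I_n.+1) : neg_decreasing t -> 0 < (-1) ^+ j * lagr_den t j.
Proof.
move=> [_ t_dec].
have -> : (-1) ^+ j = \prod_(k < n.+1 | k != j) (if (k < j)%N then -1 else 1 : R).
  rewrite -big_mkcondr /=.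
  have -> : \prod_(k < n.+1 | (k != j) && (k < j)%N) (-1 : R) =
            \prod_(k < n.+1 | (k < j)%N) -1.
    by apply: eq_bigl => k; rewrite -val_eqE /=; case: ltngtP.
  by rewrite -(big_ord_widen _ (fun=> -1)) 1?ltnW // prodr_const card_ord.
rewrite -big_split; apply: prodr_gt0 => k /=.
rewrite -val_eqE /= neq_ltn => /orP[lt_kj | lt_jk].
  by rewrite lt_kj mulN1r opprB subr_gt0 t_dec.
by rewrite ltnNge ltnW //= mul1r subr_gt0 t_dec.
Qed.

Lemma lagr_den_neq0 t j : neg_decreasing t -> lagr_den t j != 0.
Proof.
move=> /(lagr_den_sign j) gt0; apply: contraTneq gt0 => ->.
by rewrite mulr0 ltxx.
Qed.

(** Column [j] lists the coefficients of the [j]-th Lagrange basis polynomial, whose values at the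
    nodes form column [j] of the identity. *)
Definition vander_inv t : 'M[R]_n.+1 :=
  \matrix_(i, j) ((lagr_num t j)`_i / lagr_den t j).

Lemma mul_vander_inv t : neg_decreasing t -> vander t *m vander_inv t = 1%:M.
Proof.
move=> t_nd; apply/matrixP => a j; rewrite !mxE.
have := horner_lagr_num t j a.
rewrite (horner_coef_wide _ (size_lagr_num t j)) => E.
transitivity ((\sum_(i < n.+1) (lagr_num t j)`_i * t 0 a ^+ i) / lagr_den t j).
  rewrite big_distrl; apply: eq_bigr => i _; rewrite !mxE /=.
  by rewrite mulrA [t 0 a ^+ i * _]mulrC.
by rewrite E; case: eqP => _; rewrite ?mul0r // divff // lagr_den_neq0.
Qed.

Lemma invmx_vander t : neg_decreasing t ->
  vander t \in unitmx /\ invmx (vander t) = vander_inv t.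
Proof.
move=> /mul_vander_inv VX; have [uV _] := mulmx1_unit VX; split=> //.
by rewrite -[RHS](mulKmx uV) VX mulmx1.
Qed.

Section HRA.
Variables (k : nat) (P : 'rV[R]_k -> Prop) (io : 'I_n.+1 -> 'I_k).
(** The map [io] locates the nodes among the initial data, so that the results serve both for data
    [t] and for data [t] followed by [d]. *)
Let nodes (x : 'rV[R]_k) : 'rV[R]_n.+1 := \row_i x 0 (io i).
Hypothesis nodes_nd : forall x, P x -> neg_decreasing (nodes x).

(** Multiplying by [X - t_l] with [- t_l > 0] only adds nonnegative numbers; accuracy and sign go
    through the same induction. *)
Lemma hexpr_lagr_num j i : hexpr P (fun x => (lagr_num (nodes x) j)`_i) /\
  forall x, P x -> 0 <= (lagr_num (nodes x) j)`_i.
Proof.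
suff main (r : seq 'I_n.+1) : forall i,
    hexpr P (fun x => (\prod_(l <- r) ('X - (nodes x 0 l)%:P))`_i) /\
    forall x, P x -> 0 <= (\prod_(l <- r) ('X - (nodes x 0 l)%:P))`_i.
  have [h1 h2] := main [seq l <- index_enum 'I_n.+1 | l != j] i.
  split=> [|x Px]; last by rewrite /lagr_num -big_filter h2.
  by apply: hexpr_ext h1 => x _; rewrite /lagr_num big_filter.
elim: r => [|l r IHr] {}i.
  have E (x : 'rV[R]_k) : (\prod_(l <- [::]) ('X - (nodes x 0 l)%:P))`_i = (i == 0)%:R.
    by rewrite big_nil coef1.
  split=> [|x _]; last by rewrite E ler0n.
  apply: (@hexpr_ext _ _ _ _ _ (fun x _ => esym (E x))).
  by case: (i == 0%N); [apply: hexpr1 | apply: hexpr0].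
have E (x : 'rV[R]_k) : (\prod_(l' <- l :: r) ('X - (nodes x 0 l')%:P))`_i =
   (if i == 0%N then 0 else (\prod_(l' <- r) ('X - (nodes x 0 l')%:P))`_i.-1) +
   (- x 0 (io l)) * (\prod_(l' <- r) ('X - (nodes x 0 l')%:P))`_i.
  by rewrite big_cons mulrBl coefB coefXM coefCM mulNr mxE.
have [hr1 r1] := IHr i.-1; have [hr r0] := IHr i.
have ge1 x : P x -> 0 <=
    (if i == 0%N then 0 else (\prod_(l' <- r) ('X - (nodes x 0 l')%:P))`_i.-1).
  by move=> Px; case: ifP => // _; apply: r1.
have ge2 x : P x -> 0 <= (- x 0 (io l)) *
    (\prod_(l' <- r) ('X - (nodes x 0 l')%:P))`_i.
  move=> Px; rewrite mulr_ge0 ?r0 // oppr_ge0 ltW //.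
  by have := neg_decreasing_lt0 l (nodes_nd Px); rewrite mxE.
split=> [|x Px]; last by rewrite E addr_ge0 ?ge1 ?ge2.
apply: (@hexpr_ext _ _ _ _ _ (fun x _ => esym (E x))).
apply: hexpr_add => [x Px||]; first by rewrite mulr_ge0 ?ge1 ?ge2.
  by case: (i == 0%N) => //; apply: hexpr0.
by apply: hexpr_mul hr; apply: hexpr_opp; apply: hexpr_reg.
Qed.

Lemma hexpr_lagr_den j : hexpr P (fun x => lagr_den (nodes x) j).
Proof.
have E (x : 'rV[R]_k) : lagr_den (nodes x) j =
    \prod_l (if l != j then x 0 (io j) - x 0 (io l) else 1).
  by rewrite /lagr_den big_mkcond; apply: eq_bigr => l _; rewrite !mxE.
apply: (@hexpr_ext _ _ _ _ _ (fun x _ => esym (E x))).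
apply: hexpr_prod => l.
by case: (l != j); [apply: hexpr_subreg | apply: hexpr1].
Qed.

Lemma hexpr_vander_inv i j : hexpr P (fun x => vander_inv (nodes x) i j).
Proof.
have E (x : 'rV[R]_k) : vander_inv (nodes x) i j =
    (lagr_num (nodes x) j)`_i / lagr_den (nodes x) j by rewrite mxE.
apply: (@hexpr_ext _ _ _ _ _ (fun x _ => esym (E x))).
apply: hexpr_div (hexpr_lagr_den j) => [x Px|]; first by apply/lagr_den_neq0/nodes_nd.
by have [] := hexpr_lagr_num j i.
Qed.

(** The signs alternate along each row of the inverse, which matches an alternating right-hand
    side. *)
Lemma vander_inv_sign (i j : 'I_n.+1) x : P x -> 0 <= (-1) ^+ j * vander_inv (nodes x) i j.
Proof.
move=> Px; have [_ ge0] := hexpr_lagr_num j i.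
rewrite mxE mulrCA mulr_ge0 ?ge0 //.
have := lagr_den_sign j (nodes_nd Px); set D := lagr_den _ _ => gt0.
rewrite -(pmulr_rge0 _ gt0) mulrACA -expr2 sqrr_sign mul1r divff ?ler01 //.
exact/lagr_den_neq0/nodes_nd.
Qed.

End HRA.
End Lagrange.

Lemma inverse_HRA (R : realType) (n : nat) :
  HRA_computable (O := ('I_n.+1 * 'I_n.+1)%type)
    (fun t : 'rV[R]_n.+1 => neg_decreasing t)
    (fun t y => forall i j : 'I_n.+1, y (i, j) = invmx (vander t) i j).
Proof.
have nodesE (t : 'rV[R]_n.+1) : \row_i t 0 i = t.
  by apply/rowP => i; rewrite mxE.
apply: (@hexpr_HRA R n.+1 _ ('I_n.+1 * 'I_n.+1)%type
  (fun o t => vander_inv t o.1 o.2)).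
- case=> i j /=; have := @hexpr_vander_inv R n n.+1 (@neg_decreasing R n) id _ i j.
  by move=> h; apply: hexpr_ext (h _) => t; rewrite nodesE.
- by move=> t /invmx_vander[_ ->].
- by move=> t y /invmx_vander[_ ->] spec [i j]; apply: spec.
Qed.

Lemma alternating_sign (R : realType) n (d : 'rV[R]_n.+1) (j : 'I_n.+1) :
  (0 < n)%N -> alternating d -> 0 < d 0 ord0 * ((-1) ^+ j * d 0 j).
Proof.
move=> n_gt0 d_alt.
have d0 : d 0 ord0 != 0.
  (* [0 < n] gives [d_0] a neighbour, and their negative product excludes [d_0 = 0]. *)
  have := d_alt ord0 (inord 1); rewrite inordK // => /(_ erefl).
  by apply: contraTneq => ->; rewrite mul0r ltxx.
case: j => j lt_j; elim: j lt_j => [|j IHj] lt_j.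
  rewrite (_ : Ordinal lt_j = ord0); last exact: val_inj.
  by rewrite mul1r -expr2 exprn_even_gt0.
have := IHj (ltnW lt_j); have := d_alt (Ordinal (ltnW lt_j)) (Ordinal lt_j) erefl.
set b := d 0 _; set c := d 0 _; set a := d 0 _ => /= bc.
have b2 : 0 < b ^+ 2.
  by rewrite exprn_even_gt0 //=; apply: contraTneq bc => ->; rewrite mul0r ltxx.
move=> ab; rewrite -(pmulr_rgt0 _ b2) [(-1) ^+ _.+1]exprS.
have -> : b ^+ 2 * (a * (-1 * (-1) ^+ j * c)) =
  (a * ((-1) ^+ j * b)) * - (b * c) by ring.
by rewrite mulr_gt0 // oppr_gt0.
Qed.

(** The alternations of [V^-1] and of [d] compensate: in each entry of [V^-1 d] no term has the sign
    opposite to [d_0]. *)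
Lemma solve_HRA (R : realType) (n : nat) : (0 < n)%N ->
  HRA_computable (O := 'I_n.+1)
    (fun x : 'rV[R]_(n.+1 + n.+1) =>
       neg_decreasing (lsubmx x) /\ alternating (rsubmx x))
    (fun x y => vander (lsubmx x) *m (\col_i y i) = (rsubmx x)^T).
Proof.
move=> n_gt0; set P := (fun x => _ /\ _).
have nodesE (x : 'rV[R]_(n.+1 + n.+1)) : \row_i x 0 (lshift n.+1 i) = lsubmx x.
  by apply/rowP => i; rewrite !mxE.
have P_nd x : P x -> neg_decreasing (\row_i x 0 (lshift n.+1 i)).
  by rewrite nodesE => -[].
have P_alt x : P x -> alternating (rsubmx x) by case.
apply: (@hexpr_HRA R (n.+1 + n.+1) P 'I_n.+1 (fun i x =>
  \sum_j vander_inv (\row_i x 0 (lshift n.+1 i)) i j * x 0 (rshift n.+1 j))).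
- move=> i; apply: (@hexpr_sum_sign _ _ _ _ _ _ _ (fun x => x 0 (rshift n.+1 ord0))).
  + move=> x /P_alt/(alternating_sign ord0 n_gt0); rewrite !mxE.
    by apply: contraTneq => ->; rewrite mul0r ltxx.
  + move=> j x _ Px; have := alternating_sign j n_gt0 (P_alt x Px).
    have := vander_inv_sign P_nd i j Px; rewrite ![rsubmx x _ _]mxE.
    set v := vander_inv _ _ _; set a := x _ _; set b := x _ _ => v0 ab.
    have -> : a * (v * b) = ((-1) ^+ j * v) * (a * ((-1) ^+ j * b)).
      rewrite -[v in LHS]mul1r -[X in X * v](sqrr_sign R j) expr2; ring.
    by rewrite mulr_ge0 // ltW.
  + move=> j _; apply: hexpr_mul; last exact: hexpr_reg.
    exact: hexpr_vander_inv.
- move=> x Px; have := invmx_vander (P_nd x Px); rewrite nodesE => -[uV invV].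
  rewrite -[RHS](mulKVmx uV) invV; congr (_ *m _).
  apply/colP => i; rewrite [LHS]mxE [RHS]mxE; apply: eq_bigr => j _.
  by rewrite [_^T _ _]mxE [rsubmx x _ _]mxE.
- move=> x y Px spec i; have := invmx_vander (P_nd x Px).
  rewrite nodesE => -[uV invV].
  have /colP/(_ i) : \col_i y i = invmx (vander (lsubmx x)) *m (rsubmx x)^T.
    by rewrite -spec mulKmx.
  rewrite mxE => ->; rewrite mxE invV; apply: eq_bigr => j _.
  by rewrite [_^T _ _]mxE [rsubmx x _ _]mxE.
Qed.

(** * Spectrum of a Gram matrix *)

Lemma char_poly_conj (F : comUnitRingType) n (P A : 'M[F]_n) :
  P \in unitmx -> char_poly (invmx P *m A *m P) = char_poly A.
Proof.
move=> Pu; pose c := map_mx (@polyC F) (m := n) (n := n).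
have cVc : c (invmx P) *m c P = 1%:M by rewrite -map_mxM mulVmx // map_mx1.
have E : char_poly_mx (invmx P *m A *m P) = c (invmx P) *m char_poly_mx A *m c P.
  rewrite /char_poly_mx mulmxBr mulmxBl !map_mxM /=; congr (_ - _).
  by rewrite scalar_mxC -mulmxA cVc mulmx1.
rewrite /char_poly E !det_mulmx mulrAC -det_mulmx cVc det1.
by rewrite mul1r.
Qed.

Lemma conj_mxX (F : comUnitRingType) n (P : 'M[F]_n.+1) (d : 'rV[F]_n.+1) p :
  P \in unitmx -> (invmx P *m diag_mx d *m P) ^+ p =
  invmx P *m diag_mx (\row_i d 0 i ^+ p) *m P.
Proof.
move=> Pu; elim: p => [|p IHp].
  have -> : diag_mx (\row_i d 0 i ^+ 0) = 1%:M.
    by apply/matrixP=> i j; rewrite !mxE expr0.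
  by rewrite mulmx1 mulVmx.
rewrite exprS IHp -[_ * _]/(_ *m _) -!mulmxA; congr (_ *m _).
rewrite mulKVmx // !mulmxA; congr (_ *m _).
by rewrite mulmx_diag; congr diag_mx; apply/rowP => i; rewrite !mxE exprS.
Qed.

Section GramSpectrum.
Variables (R : realType) (n : nat) (W : 'M[R]_n.+1).
Local Open Scope complex_scope.
Let f : {rmorphism R -> R[i]} := real_complex R.
Let A : 'M[R[i]]_n.+1 := map_mx f (W^T *m W).
Local Open Scope sesquilinear_scope.

Let fC x : Num.conj (f x) = f x.
Proof. by apply/CrealP; rewrite complex_real. Qed.

(** Over [R[i]] the real symmetric matrix is normal, so the spectral theorem applies; with [Z] the
    image of [W] under the unitary change of basis, the diagonal part is [Z^* Z], hence real and
    nonnegative. *)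
Lemma gram_diag : exists (P : 'M[R[i]]_n.+1) (l : 'I_n.+1 -> R),
  [/\ P \in unitmx, forall i, 0 <= l i & A = invmx P *m diag_mx (\row_i f (l i)) *m P].
Proof.
have AtC : A ^t* = A.
  apply/matrixP => i j; rewrite !mxE [LHS]fC; congr (f _).
  by apply: eq_bigr => k _; rewrite !mxE mulrC.
have A_normal : A \is normalmx by apply/normalmxP; rewrite AtC.
have A_E := orthomx_spectralP A_normal.
set P := spectralmx A in A_E; set d := spectral_diag A in A_E.
have Pu : P \in unitmx by apply: spectral_unit.
have P_unitary : P \is unitarymx by apply: spectral_unitarymx.
have d_ge0 i : 0 <= d 0 i.
  pose Z := map_mx f W *m P ^t*.
  have E : diag_mx d = Z ^t* *m Z.
    have -> : diag_mx d = P *m A *m invmx P by rewrite A_E !mulmxA mulmxV // mul1mx mulmxK.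
    rewrite /Z trmx_mul map_mxM trmxCK invmx_unitary // -!mulmxA; congr (_ *m _).
    rewrite /A map_mxM -mulmxA; congr (_ *m _).
    by apply/matrixP => a b; rewrite !mxE [RHS]fC.
  have := congr1 (fun M : 'M_n.+1 => M i i) E.
  rewrite /= !mxE eqxx mulr1n => ->; apply: sumr_ge0 => j _.
  by rewrite !mxE mulrC mul_conjC_ge0.
have dE : \row_i f (complex.Re (d 0 i)) = d.
  apply/rowP => i; rewrite mxE; have := d_ge0 i.
  by case: (d 0 i) => a b; rewrite lecE /= => /andP[/eqP-> _].
exists P, (fun i => complex.Re (d 0 i)); split; first exact: Pu.
  by move=> i; have := d_ge0 i; rewrite lecE => /andP[].
by rewrite dE; exact: A_E.
Qed.

End GramSpectrum.

Definition trace_minors (F : comNzRingType) n k (A : 'M[F]_n.+1) : F :=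
  \sum_(S : {set 'I_n.+1} | #|S| == k) minor k S S A.

(** Conjugation leaves [trace_minors] unchanged, and on a diagonal matrix it is the [k]-th
    elementary symmetric function of the diagonal. *)
Lemma gram_spectrum (R : realType) n (W : 'M[R]_n.+1) :
  exists l : 'I_n.+1 -> R,
  [/\ forall i, 0 <= l i, char_poly (W^T *m W) = \prod_i ('X - (l i)%:P) &
      forall k p, trace_minors k ((W^T *m W) ^+ p) =
        \sum_(S : {set 'I_n.+1} | #|S| == k) \prod_(i in S) l i ^+ p].
Proof.
pose f : {rmorphism R -> R[i]} := real_complex R.
have [P [l [Pu l_ge0 PE]]] := gram_diag W; exists l; split=> // [|k p].
  apply: (map_poly_inj f); rewrite map_char_poly PE char_poly_conj //.
  rewrite char_poly_trig ?diag_mx_is_trig // rmorph_prod; apply: eq_bigr => i _.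
  by rewrite !mxE eqxx mulr1n rmorphB /= map_polyX map_polyC.
apply: (fmorph_inj f); rewrite /trace_minors !rmorph_sum /=.
have E (S : {set 'I_n.+1}) : f (minor k S S ((W^T *m W) ^+ p)) =
    minor k S S (map_mx f (W^T *m W) ^+ p).
  rewrite -det_map_mx -rmorphXn /=.
  by congr (\det _); apply/matrixP => i j; rewrite !mxE.
under eq_bigr do rewrite E.
rewrite PE conj_mxX // trace_minorC mulmxA mulmxV // mul1mx.
apply: eq_bigr => S /eqP Sk; rewrite minor_diag // rmorph_prod.
by apply: eq_bigr => i _; rewrite !mxE rmorphXn.
Qed.

Lemma nonincreasing_perm (R : realDomainType) n (l : 'I_n -> R) :
  exists s : 'S_n, forall i j : 'I_n, (i <= j)%N -> l (s j) <= l (s i).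
Proof.
pose t := [tuple l i | i < n].
have /tuple_permP[s sE] : perm_eq (sort >=%R t) t by rewrite perm_sort.
exists s => i j le_ij; have := sort_sorted (@ge_total _ R) t.
have lE (k : 'I_n) : l (s k) = nth 0 (sort >=%R t) k.
  rewrite sE -[RHS](tnth_nth 0 [tuple tnth t (s i) | i < n] k) !tnth_mktuple.
  by [].
rewrite !lE => /(sorted_leq_nth ge_trans (fun=> lexx _) 0); apply => //;
  by rewrite inE size_sort size_tuple.
Qed.

Lemma sum_prod_subset_perm (F : comNzRingType) n k (s : 'S_n) (g : 'I_n -> F) :
  \sum_(S : {set 'I_n} | #|S| == k) \prod_(i in S) g (s i) =
  \sum_(S : {set 'I_n} | #|S| == k) \prod_(i in S) g i.
Proof.
rewrite [RHS](reindex_inj (imset_inj (@perm_inj _ s))) /=.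
apply: eq_big => [S|S _]; first by rewrite card_imset //; apply: perm_inj.
by rewrite big_imset //= => i j _ _; apply: perm_inj.
Qed.

Lemma singular_values_ex (R : realType) n (W : 'M[R]_n.+1) :
  exists y, is_singular_values W y.
Proof.
have [l [l_ge0 lE _]] := gram_spectrum W.
have [s s_dec] := nonincreasing_perm l.
exists (fun i => Num.sqrt (l (s i))); split=> [i|i j /s_dec|].
- exact: sqrtr_ge0.
- exact: ler_wsqrtr.
- rewrite lE (reindex_inj (@perm_inj _ s)); apply: eq_bigr => i _.
  by rewrite sqr_sqrtr.
Qed.

(** The [y_i^2] and the eigenvalues of [gram_spectrum] are the roots of one polynomial, hence agree
    up to a permutation, which a symmetric function ignores. *)
Lemma trace_minors_gram (R : realType) n (W : 'M[R]_n.+1) y k p :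
  is_singular_values W y -> trace_minors k ((W^T *m W) ^+ p) =
    \sum_(S : {set 'I_n.+1} | #|S| == k) \prod_(i in S) (y i ^+ 2) ^+ p.
Proof.
move=> [_ _ yE]; have [l [_ lE ->]] := gram_spectrum W.
have : perm_eq [tuple l i | i < n.+1] [tuple y i ^+ 2 | i < n.+1].
  apply: prod_XsubC_eq; rewrite !big_image /=.
  by rewrite -lE yE.
case/tuple_permP => s sE.
have lyE i : l i = y (s i) ^+ 2.
  have := congr1 (fun t => nth 0 t i) sE.
  rewrite -[nth _ _ i](tnth_nth 0 [tuple l i | i < n.+1]).
  rewrite -[in RHS](tnth_nth 0 [tuple tnth [tuple y i ^+ 2 | i < n.+1] (s i) | i < n.+1]).
  by rewrite !tnth_mktuple.
rewrite -[RHS](sum_prod_subset_perm k s); apply: eq_bigr => S _.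
by apply: eq_bigr => i _; rewrite lyE.
Qed.

(** * Compound matrices *)

(** The branching rule itself is the algorithm: it involves only products, differences of nodes and
    sums of nonnegative terms. *)
Lemma hexpr_det_gvander (R : realType) n k (f : 'I_k -> 'I_n.+1) (a : 'I_k -> nat) :
  {homo f : i j / (i < j)%N} -> {homo a : i j / (i < j)%N} ->
  hexpr (@neg_decreasing R n) (fun t => \det (gvander (fun i => - t 0 (f i)) a)).
Proof.
elim: k f a => [|k IHk] f a f_inc a_inc.
  by apply: hexpr_ext (hexpr1 _) => t _; rewrite det_mx00.
pose M := \max_j a j.
have leM j : (a j <= M)%N by apply: leq_bigmax.
have f'_inc : {homo (fun i => f (lift ord0 i)) : i j / (i < j)%N}.
  by move=> i j lt_ij; apply: f_inc; rewrite /= /bump /= !add1n ltnS.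
apply: hexpr_ext; first by move=> t _; rewrite (det_gvander_rec _ a_inc leM).
apply: hexpr_mul.
  apply: hexpr_mul; first exact/hexpr_exp/hexpr_opp/hexpr_reg.
  apply: hexpr_prod => i.
  apply: hexpr_ext (hexpr_subreg _ (f ord0) (f (lift ord0 i))) => t _.
  by rewrite opprK addrC.
apply: hexpr_sum => [m t m_in t_nd | m m_in].
  apply: mulr_ge0.
    by apply: prodr_ge0 => j _; rewrite exprn_ge0 // oppr_ge0 ltW // neg_decreasing_lt0.
  apply/ltW/det_gvander_gt0; last exact: gvander_interlace m_in.
    by move=> i; rewrite oppr_gt0 neg_decreasing_lt0.
  by move=> i j /f'_inc; rewrite ltrN2; apply: (proj2 t_nd).
apply: hexpr_mul; last by apply: IHk => //; apply: gvander_interlace m_in.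
by apply: hexpr_prod => j; exact/hexpr_exp/hexpr_opp/hexpr_reg.
Qed.

Section Minors.
Variables (R : realType) (n : nat).
Implicit Types (S T U : {set 'I_n.+1}).

Lemma minor_vanderJE k S T (t : 'rV[R]_n.+1) : minor k S T (vanderJ t) =
  \det (gvander (fun i : 'I_k => - t 0 (elt S i)) (fun j => elt T j)).
Proof. by rewrite /minor vanderJ_sub. Qed.

Lemma minor_vanderJ_gt0 k S T t : neg_decreasing t -> #|S| = k -> #|T| = k ->
  0 < minor k S T (vanderJ t) :> R.
Proof.
move=> t_nd Sk Tk; rewrite minor_vanderJE.
apply: det_gvander_gt0 => [i|i j lt_ij|]; last exact: elt_homo.
  by rewrite oppr_gt0 neg_decreasing_lt0.
by rewrite ltrN2; apply: (proj2 t_nd); apply: elt_homo.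
Qed.

Lemma minor_gram k S T (A : 'M[R]_n.+1) : minor k S T (A^T *m A) =
  \sum_(U : {set 'I_n.+1} | #|U| == k) minor k U S A * minor k U T A.
Proof. by rewrite minorM; apply: eq_bigr => U _; rewrite minor_tr. Qed.

Lemma minor_gram_ge0 k S T t : neg_decreasing t -> #|S| = k -> #|T| = k ->
  0 <= minor k S T ((vanderJ t)^T *m vanderJ t) :> R.
Proof.
move=> t_nd Sk Tk; rewrite minor_gram; apply: sumr_ge0 => U /eqP Uk.
by apply: mulr_ge0; apply/ltW/minor_vanderJ_gt0.
Qed.

Lemma hexpr_minor_gram k S T : #|S| = k -> #|T| = k ->
  hexpr (@neg_decreasing R n) (fun t => minor k S T ((vanderJ t)^T *m vanderJ t)).
Proof.
move=> Sk Tk; apply: hexpr_ext; first by move=> t _; rewrite minor_gram.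
have hm (U V : {set 'I_n.+1}) : #|U| = k -> #|V| = k ->
    hexpr (@neg_decreasing R n) (fun t => minor k U V (vanderJ t)).
  move=> Uk Vk; apply: hexpr_ext; first by move=> t _; rewrite minor_vanderJE.
  by apply: hexpr_det_gvander; apply: elt_homo.
apply: hexpr_sum => [U t /eqP Uk t_nd | U /eqP Uk].
  by apply: mulr_ge0; apply/ltW/minor_vanderJ_gt0.
by apply: hexpr_mul; apply: hm.
Qed.

(** All compound matrices at once, as diagonal blocks of a matrix indexed by all subsets; the zeros
    between different sizes let the product rule sum over every [U]. *)
Definition compound (A : 'M[R]_n.+1) (ST : {set 'I_n.+1} * {set 'I_n.+1}) : R :=
  if #|ST.1| == #|ST.2| then minor #|ST.1| ST.1 ST.2 A else 0.

Lemma compoundM A B S T :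
  compound (A *m B) (S, T) = \sum_U compound A (S, U) * compound B (U, T).
Proof.
rewrite /compound /=; case: eqVneq => [ST | neST].
  rewrite minorM big_mkcond; apply: eq_bigr => U _ /=; rewrite eq_sym.
  by case: eqVneq => [SU|_]; rewrite ?mul0r // -SU ST eqxx.
rewrite big1 // => U _; case: eqVneq => [SU|_]; last by rewrite mul0r.
by rewrite -SU (negPf neST) mulr0.
Qed.

Lemma trace_minors_compound k (A : 'M[R]_n.+1) :
  trace_minors k A = \sum_(S : {set 'I_n.+1} | #|S| == k) compound A (S, S).
Proof. by apply: eq_bigr => S /eqP Sk; rewrite /compound /= eqxx Sk. Qed.

Lemma compound_ge0 t j ST : neg_decreasing t ->
  0 <= compound (((vanderJ t)^T *m vanderJ t) ^+ (2 ^ j)) ST.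
Proof.
move=> t_nd; elim: j ST => [|j IHj] [S T].
  rewrite expn0 expr1 /compound /=; case: eqP => // ST.
  by rewrite minor_gram_ge0.
rewrite expnS mul2n -addnn exprD compoundM.
by apply: sumr_ge0 => U _; apply: mulr_ge0.
Qed.

Lemma hexpr_compound ST : hexpr (@neg_decreasing R n)
  (fun t => compound ((vanderJ t)^T *m vanderJ t) ST).
Proof.
case: ST => S T; rewrite /compound /=; case: eqP => ST; last exact: hexpr0.
exact: hexpr_minor_gram.
Qed.

Lemma sign_mx_mul : sign_mx R n *m sign_mx R n = 1%:M.
Proof.
rewrite /sign_mx mulmx_diag; apply/matrixP => i j; rewrite !mxE.
by rewrite -expr2 sqrr_sign.
Qed.

(** [J] is its own inverse and transpose, so the two Gram matrices are conjugate. *)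
Lemma singular_values_vanderJ (t : 'rV[R]_n.+1) y :
  is_singular_values (vander t) y <-> is_singular_values (vanderJ t) y.
Proof.
have [Ju _] := mulmx1_unit sign_mx_mul.
have invJ : invmx (sign_mx R n) = sign_mx R n.
  by rewrite -[RHS](mulKmx Ju) sign_mx_mul mulmx1.
have E : (vanderJ t)^T *m vanderJ t =
    invmx (sign_mx R n) *m ((vander t)^T *m vander t) *m sign_mx R n.
  rewrite invJ /vanderJ trmx_mul tr_diag_mx !mulmxA.
  by [].
by rewrite /is_singular_values E char_poly_conj.
Qed.

Lemma det_vanderJ_gt0 (t : 'rV[R]_n.+1) : neg_decreasing t -> 0 < \det (vanderJ t).
Proof.
move=> t_nd; rewrite -(mxsub_id (vanderJ t)) vanderJ_sub.
apply: det_gvander_gt0 => // [i|i j lt_ij].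
  by rewrite oppr_gt0 neg_decreasing_lt0.
by rewrite ltrN2; apply: (proj2 t_nd).
Qed.

Lemma singular_values_gt0 (A : 'M[R]_n.+1) y : \det A != 0 ->
  is_singular_values A y -> forall i, 0 < y i.
Proof.
move=> detA [y_ge0 _ yE] i; rewrite lt_def y_ge0 andbT.
have := char_poly_det (A^T *m A); rewrite yE det_mulmx det_tr -horner_coef0.
rewrite horner_prod => E; have : \prod_j ('X - (y j ^+ 2)%:P).[0] != 0.
  by rewrite E !mulf_neq0 // signr_eq0.
move/prodf_neq0/(_ i isT); rewrite hornerXsubC sub0r oppr_eq0.
by apply: contraNneq => ->; rewrite expr0n.
Qed.

End Minors.

(** * Elementary symmetric functions compared with their largest term *)

Section TopProduct.
Variables (R : realType) (n : nat) (y : 'I_n.+1 -> R).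
Hypotheses (y_ge0 : forall i, 0 <= y i)
  (y_dec : forall i j : 'I_n.+1, (i <= j)%N -> y j <= y i).

Definition top_prod (k : nat) : R := \prod_(i < n.+1 | (i < k)%N) y i ^+ 2.

Lemma top_prod_ge0 k : 0 <= top_prod k.
Proof. by apply: prodr_ge0 => i _; apply: sqr_ge0. Qed.

Lemma top_prodS (i : 'I_n.+1) : top_prod i.+1 = top_prod i * y i ^+ 2.
Proof.
rewrite /top_prod (bigD1 i) //= mulrC; congr (_ * _).
by apply: eq_bigl => j; rewrite ltnS ltn_neqAle andbC -val_eqE.
Qed.

Let ord_le_elt k (S : {set 'I_n.+1}) (i : 'I_k) : #|S| = k -> (i <= elt S i)%N.
Proof.
move=> Sk; case: i => i lt_i; elim: i lt_i => //= i IHi lt_i.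
by apply: leq_ltn_trans (IHi (ltnW lt_i)) (elt_homo Sk _).
Qed.

(** The first [k] indices give the lower bound. The [i]-th element of any [k]-subset is at least
    [i], so no product exceeds that one; the number of all subsets is a crude count valid for every
    [k]. *)
Lemma sum_prod_top k p : (k <= n.+1)%N ->
  top_prod k ^+ p <=
    \sum_(S : {set 'I_n.+1} | #|S| == k) \prod_(i in S) (y i ^+ 2) ^+ p <=
  #|{set 'I_n.+1}|%:R * top_prod k ^+ p.
Proof.
move=> le_k.
have nn (S : {set 'I_n.+1}) : 0 <= \prod_(i in S) (y i ^+ 2) ^+ p.
  by apply: prodr_ge0 => i _; apply/exprn_ge0/sqr_ge0.
apply/andP; split.
  pose S0 := [set i : 'I_n.+1 | (i < k)%N].
  have S0k : #|S0| == k.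
    rewrite -sum1dep_card -(big_ord_widen _ (fun=> 1%N)) //.
    by rewrite sum1_card card_ord.
  rewrite (bigD1 S0) //= /top_prod -prodrXl.
  have -> : \prod_(i < n.+1 | (i < k)%N) (y i ^+ 2) ^+ p =
            \prod_(i in S0) (y i ^+ 2) ^+ p.
    by apply: eq_bigl => i; rewrite inE.
  by rewrite lerDl; apply: sumr_ge0.
have le_top (S : {set 'I_n.+1}) : #|S| == k ->
    \prod_(i in S) (y i ^+ 2) ^+ p <= top_prod k ^+ p.
  move=> /eqP Sk; rewrite -(prod_elt Sk) prodrXl lerXn2r ?nnegrE ?top_prod_ge0 //.
    by apply: prodr_ge0 => i _; apply: sqr_ge0.
  rewrite /top_prod.
  have -> : \prod_(i < n.+1 | (i < k)%N) y i ^+ 2 = \prod_(i < k) y (inord i) ^+ 2.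
    rewrite (big_ord_widen _ (fun i => y (inord i) ^+ 2) le_k).
    by apply: eq_bigr => i _; rewrite inord_val.
  apply: ler_prod => i _; rewrite sqr_ge0 lerXn2r ?nnegrE //=.
  apply: y_dec; rewrite inordK ?ord_le_elt //.
  exact: leq_trans (ltn_ord i) le_k.
apply: (le_trans (ler_sum _ le_top)).
rewrite sumr_const -[leLHS]mulr_natl ler_wpM2r ?exprn_ge0 ?top_prod_ge0 //.
by rewrite ler_nat max_card.
Qed.

End TopProduct.

(** * Choosing the number of squarings *)

Section Counter.
Variables (R : realType) (A : fparith R).
Local Notation u := (roundoff A).
Let u_gt0 : 0 < u := roundoff_gt0 A.
Let u_le : u <= 2^-1 := roundoff_le A.

(* Subtracting [u] from 1 until the result is nonpositive terminates for every
   arithmetic, and takes at least [1 / (2 u)] steps. *)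
Definition counter (j : nat) : R := iter j (fun w => fl_sub A w u) 1.

(** From a value in [(0, 1]] the rounding error is at most [u (1 - u)], so one step subtracts
    between [u^2] and [2 u]. *)
Lemma counter_bounds j : (forall i, (i < j)%N -> 0 < counter i) ->
  1 - (u *+ 2) *+ j <= counter j <= 1 - u ^+ 2 *+ j.
Proof.
elim: j => [|j IHj] pos; first by rewrite !mulr0n subr0 /= lexx.
have /andP[lo hi] := IHj (fun i lt_i => pos i (leqW lt_i)).
have w_gt0 := pos j (ltnSn j).
have := fl_subP A (counter j) u; rewrite -[fl_sub _ _ _]/(counter j.+1) -/u.
move: (u_gt0) (u_le) => u0 u2; move: (sqr_ge0 u) => us.
have w_le1 : counter j <= 1.
  by apply: le_trans hi _; rewrite gerBl mulrn_wge0.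
set w' := counter j.+1; move: (counter j) w_gt0 w_le1 lo hi => w w0 w1 lo hi.
have uw : `|w - u| <= 1 - u by rewrite ler_norml; apply/andP; split; lra.
have le_uu : u * `|w - u| <= u * (1 - u) by rewrite ler_wpM2l // ltW.
move=> /le_trans/(_ le_uu); rewrite ler_norml => /andP[h1 h2].
rewrite ![_ *+ j.+1]mulrS; move: h1 h2 lo hi; set a := _ *+ j; set b := _ *+ j.
have -> : u * (1 - u) = u - u ^+ 2 by ring.
have u2u : u ^+ 2 <= u by rewrite expr2 ler_piMr; lra.
by move=> *; apply/andP; split; lra.
Qed.

(** Decrements of at least [u^2] force termination by the Archimedean property; decrements of at
    most [2 u] give [1 <= 2 u q], and [q <= 2^q]. *)
Lemma counter_stop : exists q,
  [/\ forall j, (j < q)%N -> 0 < counter j, counter q <= 0 &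
      1 <= u *+ 2 * (2 ^ q)%:R].
Proof.
have ex : exists j, counter j <= 0.
  pose m := (Num.bound (u ^- 2)).+1.
  have [/forallP pos | /forallPn[j]] := boolP [forall j : 'I_m, 0 < counter j];
    last by rewrite -leNgt; exists j.
  have /counter_bounds/andP[_ hi] : forall i, (i < m)%N -> 0 < counter i.
    by move=> i lt_i; have := pos (Ordinal lt_i).
  exists m; apply: le_trans hi _; rewrite subr_le0.
  have u2_gt0 : 0 < u ^+ 2 by rewrite exprn_gt0.
  rewrite -[leRHS]mulr_natr mulrC -ler_pdivrMr // mul1r.
  apply: le_trans (_ : (Num.bound (u ^- 2))%:R <= _); last by rewrite ler_nat.
  by rewrite ltW // archi_boundP // invr_ge0 ltW.
have [q q_le0 q_min] := ex_minnP ex; exists q.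
have pos j : (j < q)%N -> 0 < counter j.
  by move=> lt_j; rewrite ltNge; apply/negP => /q_min; rewrite leqNgt lt_j.
split=> //; have /andP[lo _] := counter_bounds pos.
have : 1 - u *+ 2 *+ q <= 0 by apply: le_trans q_le0.
rewrite subr_le0 => /le_trans; apply.
rewrite -[leLHS]mulr_natr; apply: ler_wpM2l; first by rewrite mulrn_wge0 // ltW.
rewrite ler_nat.
by rewrite ltnW // ltn_expl.
Qed.

End Counter.

Definition add_exprs (es : seq fexpr) : fexpr := foldr Add Zero es.

Lemma regs_below_add (B : nat) (es : seq fexpr) :
  all (regs_below B) es -> regs_below B (add_exprs es).
Proof. by elim: es => //= e es IHes /andP[-> /IHes]. Qed.

Lemma acc_add_exprs (R : realType) (A : fparith R) s I (r : seq I) (F : I -> R)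
    (e : I -> fexpr) m :
  (forall i, 0 <= F i) ->
  (forall i, acc (roundoff A) m (F i) (feval A s (e i))) ->
  acc (roundoff A) (m + size r) (\sum_(i <- r) F i) (feval A s (add_exprs (map e r))).
Proof.
have u_gt0 := roundoff_gt0 A; have u_le := roundoff_le A.
move=> F0 Fe; elim: r => [|i r IHr]; first by rewrite big_nil; apply: acc_refl.
rewrite big_cons addnS; apply: acc_fl (fl_addP _ _ _) => //.
apply: acc_add => //; last by apply: acc_le (Fe i); rewrite ?leq_addr.
by rewrite mulr_ge0 // sumr_ge0.
Qed.

(** * Iterated square roots *)

Section IterSqrt.
Variable R : realType.

Lemma iter_sqrt_ge0 j (x : R) : 0 <= x -> 0 <= iter j Num.sqrt x.
Proof. by case: j => //= j _; apply: sqrtr_ge0. Qed.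

Lemma iter_sqrtK j (x : R) : 0 <= x -> iter j Num.sqrt (x ^+ (2 ^ j)) = x.
Proof.
move=> x0; elim: j => [|j IHj]; first by rewrite expn0 expr1.
by rewrite iterSr expnSr exprM sqrtr_sqr ger0_norm ?exprn_ge0.
Qed.

Lemma ler_iter_sqrt j (x x' : R) : x <= x' -> iter j Num.sqrt x <= iter j Num.sqrt x'.
Proof. by move=> le_x; elim: j => //= j; apply: ler_wsqrtr. Qed.

(** By Bernoulli [D <= 1 + 2 u D 2^q <= (1 + 2 u)^(D 2^q)], so [q] square roots reduce the factor
    [D] to at most [(1 + 2 u)^D]. *)
Lemma acc_iter_sqrt (u : R) (D q : nat) (x s : R) : 0 < u -> (0 < D)%N ->
  0 <= x -> 1 <= u *+ 2 * (2 ^ q)%:R ->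
  x ^+ (2 ^ q) <= s <= D%:R * x ^+ (2 ^ q) ->
  acc u D x (iter q Num.sqrt s).
Proof.
move=> u0 D0 x0 uq /andP[lo hi]; pose rho := 1 + u *+ 2.
have rho_ge1 : 1 <= rho by rewrite lerDl mulrn_wge0 // ltW.
have rho_ge0 : 0 <= rho by apply: le_trans rho_ge1.
have le_D : D%:R <= (rho ^+ D) ^+ (2 ^ q).
  have bern m : 1 + u *+ 2 *+ m <= rho ^+ m.
    elim: m => [|m IHm]; first by rewrite mulr0n addr0.
    rewrite exprS (le_trans _ (ler_wpM2l rho_ge0 IHm)) // [_ *+ m.+1]mulrSr /rho.
    have w0 : 0 <= u *+ 2 by rewrite mulrn_wge0 // ltW.
    have v0 : 0 <= u *+ 2 *+ m by rewrite mulrn_wge0.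
    move: (u *+ 2) (u *+ 2 *+ m) w0 v0 => w v w0 v0.
    have := mulr_ge0 w0 v0; lra.
  rewrite -exprM; apply: le_trans (bern _).
  have -> : u *+ 2 *+ (D * 2 ^ q) = u *+ 2 * (2 ^ q)%:R * D%:R.
    by rewrite -[LHS]mulr_natr natrM [D%:R * _]mulrC mulrA.
  have := ler_wpM2r (ler0n R D) uq; rewrite mul1r => /le_trans; apply.
  by rewrite lerDr.
have E1 : x <= iter q Num.sqrt s by rewrite -[leLHS](iter_sqrtK q) // ler_iter_sqrt.
have E2 : iter q Num.sqrt s <= rho ^+ D * x.
  have rx0 : 0 <= rho ^+ D * x by rewrite mulr_ge0 ?exprn_ge0.
  rewrite -(iter_sqrtK q rx0); apply: ler_iter_sqrt; apply: le_trans hi _.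
  by rewrite exprMn ler_wpM2r // exprn_ge0.
have [xE | xn0] := eqVneq x 0.
  have /eqP -> : iter q Num.sqrt s == 0.
    by rewrite eq_le iter_sqrt_ge0 ?(le_trans _ lo) ?exprn_ge0 // andbT (le_trans E2) // xE mulr0.
  by rewrite xE; apply: acc_refl.
have x_gt0 : 0 < x by rewrite lt_def xn0.
exists (iter q Num.sqrt s / x); first by rewrite mulrC divfK.
rewrite -/rho ler_pdivlMr // ler_pdivrMr // E2 andbT.
by apply: le_trans E1; rewrite ler_piMl // invf_le1 ?exprn_ege1 // exprn_gt0 // (lt_le_trans ltr01).
Qed.

End IterSqrt.

(** * Singular values *)

Section Program.
Variable n : nat.
Let I := {set 'I_n.+1}.
(** [None] is the counter, [inl] holds the entries of the compound matrices and [inr] the traces for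
    [k] from 0 to [n + 1]. *)
Let Q : finType := option ((I * I) + 'I_n.+2)%type.

Let reg (q : Q) : nat := state_reg n.+1 q.
Let rW : nat := reg None.
Let rM (ST : I * I) : nat := reg (Some (inl ST)).
Let rT (k : 'I_n.+2) : nat := reg (Some (inr k)).

Definition svd_out (k : 'I_n.+2) : nat := rT k.

Definition block (eW : fexpr) (eM : I * I -> fexpr) (eT : 'I_n.+2 -> fexpr) : fcmd :=
  state_par n.+1 (fun q : Q =>
    match q with None => eW | Some (inl ST) => eM ST | Some (inr k) => eT k end).

Definition decr_counter : fexpr := Defs.Sub (Reg rW) Roundoff.

Definition init_block (e : I * I -> fexpr) : fcmd := block One e (fun=> Zero).

Definition square_block : fcmd := block decr_counter
  (fun ST => add_exprs [seq Mul (Reg (rM (ST.1, U))) (Reg (rM (U, ST.2))) | U : I])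
  (fun=> Zero).

Definition trace_block : fcmd := block One (fun=> Zero)
  (fun k => add_exprs [seq (if #|U| == k then Reg (rM (U, U)) else Zero) | U : I]).

Definition sqrt_block : fcmd := block decr_counter (fun=> Zero)
  (fun k => Sqrt (Reg (rT k))).

(** For [k = 0] the register is divided by itself; the outputs begin at [k = 1]. *)
Definition quotient_block : fcmd := block One (fun=> Zero)
  (fun k => Sqrt (Div (Reg (rT k)) (Reg (rT (inord k.-1))))).

(* Both loops run the same counter, hence perform the same number of steps. *)
Definition svd_program (e : I * I -> fexpr) : fcmd :=
  Seq (init_block e)
  (Seq (WhileLt Zero (Reg rW) square_block)
  (Seq trace_block
  (Seq (WhileLt Zero (Reg rW) sqrt_block)
       quotient_block))).

Let reg_lt q : (reg q < n.+1 + #|Q|)%N. Proof. exact: state_reg_lt. Qed.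

Lemma exec_block (R : realType) (A : fparith R) s eW eM eT :
  let B := (n.+1 + #|Q|)%N in
  regs_below B eW -> (forall ST, regs_below B (eM ST)) ->
  (forall k, regs_below B (eT k)) ->
  exists2 s', exec A (block eW eM eT) s s' &
    [/\ s' rW = feval A s eW, forall ST, s' (rM ST) = feval A s (eM ST) &
        forall k, s' (rT k) = feval A s (eT k)].
Proof.
move=> B W_lt M_lt T_lt.
have [|s' exec_s' s'E] := @exec_state_par R n.+1 Q A (fun q : Q =>
    match q with None => eW | Some (inl ST) => eM ST | Some (inr k) => eT k end) s.
  by case=> [[ST|k]|].
by exists s' => //; split=> [|ST|k]; rewrite /rW /rM /rT /reg s'E.
Qed.

Section Run.
Variables (R : realType) (A : fparith R) (e : I * I -> fexpr) (m : nat).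
Let u := roundoff A.
Let u_gt0 : 0 < u := roundoff_gt0 A.
Let u_le : u <= 2^-1 := roundoff_le A.
Let D := #|I|.
(** The value of [E + D + 1] at the start of the squarings, where [E = m]. *)
Let C := (m + D + 1)%N.

(** [G j] stands for the compound of the [2^j]-th power of the Gram matrix. *)
Variables (G : nat -> I * I -> R).
Hypothesis G_ge0 : forall j ST, 0 <= G j ST.
Hypothesis G_S : forall j S T, G j.+1 (S, T) = \sum_U G j (S, U) * G j (U, T).

Let D_gt0 : (0 < D)%N. Proof. by rewrite /D; apply/card_gt0P; exists set0. Qed.

Let size_enumI : size (enum I) = D. Proof. by rewrite -cardE. Qed.

(* One squaring maps the error exponent [E] to [2 E + D + 1], so that
   [E + D + 1] exactly doubles. *)
Lemma square_step j s :
  s rW = counter A j ->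
  (exists2 E, (E + D + 1 <= 2 ^ j * C)%N & forall ST, acc u E (G j ST) (s (rM ST))) ->
  exists2 s', exec A square_block s s' & s' rW = counter A j.+1 /\
    (exists2 E, (E + D + 1 <= 2 ^ j.+1 * C)%N &
       forall ST, acc u E (G j.+1 ST) (s' (rM ST))).
Proof.
move=> sW [E leE accE].
have [| | |s' exec_s' [s'W s'M _]] := @exec_block R A s decr_counter
  (fun ST => add_exprs [seq Mul (Reg (rM (ST.1, U))) (Reg (rM (U, ST.2))) | U : I])
  (fun=> Zero).
- by rewrite /= reg_lt.
- move=> ST; apply: regs_below_add; rewrite all_map; apply/allP => U _.
  by rewrite /= !reg_lt.
- by [].
exists s' => //; split; first by rewrite s'W /= sW.
exists (E + E + 1 + D)%N; first by rewrite expnS; lia.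
case=> S T; rewrite s'M G_S -big_enum -size_enumI.
apply: (@acc_add_exprs R A s I (enum I) (fun U => G j (S, U) * G j (U, T))) => U.
  by rewrite mulr_ge0.
rewrite addn1; apply: acc_fl (fl_mulP _ _ _) => //=.
exact: acc_mul.
Qed.

Lemma trace_step q s :
  (exists2 E, (E + D + 1 <= 2 ^ q * C)%N & forall ST, acc u E (G q ST) (s (rM ST))) ->
  exists2 s', exec A trace_block s s' & s' rW = counter A 0 /\
    forall k : 'I_n.+2, acc u (2 ^ q * C)
      (\sum_(S : I | #|S| == k) G q (S, S)) (s' (rT k)).
Proof.
move=> [E leE accE].
have [| | |s' exec_s' [s'W _ s'T]] := @exec_block R A s One (fun=> Zero)
  (fun k => add_exprs [seq (if #|U| == k then Reg (rM (U, U)) else Zero) | U : I]).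
- by [].
- by [].
- move=> k; apply: regs_below_add; rewrite all_map; apply/allP => U _ /=.
  by case: ifP => //= _; rewrite reg_lt.
exists s' => //; split; first by rewrite s'W.
move=> k; rewrite s'T big_mkcond -big_enum.
apply: acc_le (_ : E + D <= _)%N _ => //; first by lia.
rewrite -size_enumI.
apply: (@acc_add_exprs R A s I (enum I) (fun S => if #|S| == k then G q (S, S) else 0)) => S.
  by case: ifP.
by case: ifP => _ //=; apply: acc_refl.
Qed.

(** The summand 2 absorbs the roundings: an exponent [2 X + 2] is halved to [X + 1], and rounding
    the root gives [X + 2]. *)
Lemma sqrt_step q j s (tau : 'I_n.+2 -> R) :
  (forall k, 0 <= tau k) -> (j < q)%N -> s rW = counter A j ->
  (forall k, acc u (2 ^ (q - j) * C + 2) (iter j Num.sqrt (tau k)) (s (rT k))) ->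
  exists2 s', exec A sqrt_block s s' & s' rW = counter A j.+1 /\
    forall k, acc u (2 ^ (q - j.+1) * C + 2) (iter j.+1 Num.sqrt (tau k)) (s' (rT k)).
Proof.
move=> tau0 lt_jq sW accT.
have [| | |s' exec_s' [s'W _ s'T]] := @exec_block R A s decr_counter (fun=> Zero)
  (fun k => Sqrt (Reg (rT k))).
- by rewrite /= reg_lt.
- by [].
- by move=> k; rewrite /= reg_lt.
exists s' => //; split; first by rewrite s'W /= sW.
move=> k; rewrite s'T /= addn2.
have x0 := iter_sqrt_ge0 j (tau0 k).
have sT0 : 0 <= s (rT k) by apply: acc_ge0 (accT k) x0.
apply: (acc_fl _ _ (y := Num.sqrt (s (rT k)))) => //; last first.
  by rewrite [`|Num.sqrt _|]ger0_norm ?sqrtr_ge0 //; apply: fl_sqrtP.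
apply: acc_sqrt => //; rewrite (_ : _.*2 = (2 ^ (q - j) * C + 2)%N) //.
by rewrite -(subnSK lt_jq) expnS -mul2n; lia.
Qed.

Lemma quotient_step s (tau : 'I_n.+2 -> R) E :
  (forall k, 0 < tau k) -> (forall k, acc u E (tau k) (s (rT k))) ->
  exists2 s', exec A quotient_block s s' &
    forall k : 'I_n.+1, acc u (E + E).+2
      (Num.sqrt (tau (inord k.+1) / tau (inord k))) (s' (rT (inord k.+1))).
Proof.
move=> tau0 accT.
have [| | |s' exec_s' [_ _ s'T]] := @exec_block R A s One (fun=> Zero)
  (fun k => Sqrt (Div (Reg (rT k)) (Reg (rT (inord k.-1))))).
- by [].
- by [].
- by move=> j; rewrite /= !reg_lt.
exists s' => // k; rewrite s'T /= inordK ?ltnS //=; last by rewrite -ltnS.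
set a := s (rT (inord k.+1)); set b := s (rT (inord k)).
have accb : acc u E (tau (inord k)) b by apply: accT.
have b0 : b != 0 by rewrite (acc_eq0 u_gt0 accb) gt_eqF.
have accd : acc u (E + E).+1 (tau (inord k.+1) / tau (inord k)) (fl_div A a b).
  apply: acc_fl (fl_divP _ _ b0) => //; apply: acc_mul => //.
  exact: acc_inv.
have d0 : 0 <= tau (inord k.+1) / tau (inord k) by rewrite divr_ge0 // ltW.
have fd0 : 0 <= fl_div A a b by apply: acc_ge0 accd d0.
apply: (acc_fl _ _ (y := Num.sqrt (fl_div A a b))) => //; last first.
  by rewrite [`|Num.sqrt _|]ger0_norm ?sqrtr_ge0 //; apply: fl_sqrtP.
apply: acc_sqrt => //; apply: acc_le accd => //.
by rewrite -addnn; lia.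
Qed.

Variable s0 : nat -> R.
Hypothesis e_below : forall ST, regs_below n.+1 (e ST).
Hypothesis e_acc : forall ST, acc u m (G 0 ST) (feval A s0 (e ST)).
Variable lam : nat -> R.
Hypothesis lam_gt0 : forall k, 0 < lam k.
Hypothesis lam_trace : forall (k : 'I_n.+2) j,
  lam k ^+ (2 ^ j) <= \sum_(S : I | #|S| == k) G j (S, S) <= D%:R * lam k ^+ (2 ^ j).

(** In the exponent, [D] accounts for the gap between [lam k] and the exact [2^q]-th root of the
    trace, and [C + 2] for the roundings up to the end of the second loop; the quotient involves two
    such errors. *)
Lemma exec_svd_program : exists2 s, exec A (svd_program e) s0 s &
  forall k : 'I_n.+1, acc u (D + (C + 2) + (D + (C + 2))).+2
    (Num.sqrt (lam k.+1 / lam k)) (s (rT (inord k.+1))).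
Proof.
have [q [w_gt0 w_le0 uq]] := counter_stop A.
have [| | |s1 exec1 [s1W s1M _]] := @exec_block R A s0 One e (fun=> Zero).
- by [].
- by move=> ST; apply: regs_below_le (e_below ST); rewrite leq_addr.
- by [].
pose Inv1 j (s : nat -> R) := s rW = counter A j /\
  (exists2 E, (E + D + 1 <= 2 ^ j * C)%N & forall ST, acc u E (G j ST) (s (rM ST))).
have [| | |s2 exec2 [_ inv2]] := @exec_loop R A Zero (Reg rW) square_block q Inv1 s1.
- move=> j s lt_jq [sW accs]; split; first by rewrite /= sW w_gt0.
  by have [s' ? ?] := square_step sW accs; exists s'.
- by move=> s [sW _]; rewrite /= sW.
- split; first by rewrite s1W.
  by exists m => [|ST]; rewrite ?s1M ?mul1n // /C.
have [s3 exec3 [s3W acc3]] := trace_step inv2.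
pose tau (k : 'I_n.+2) := \sum_(S : I | #|S| == k) G q (S, S).
have tau0 k : 0 <= tau k by apply: sumr_ge0.
pose Inv2 j (s : nat -> R) := (j <= q)%N /\ s rW = counter A j /\
  forall k, acc u (2 ^ (q - j) * C + 2) (iter j Num.sqrt (tau k)) (s (rT k)).
have [| | |s4 exec4 [_ [_ acc4]]] := @exec_loop R A Zero (Reg rW) sqrt_block q Inv2 s3.
- move=> j s lt_jq [_ [sW accs]]; split; first by rewrite /= sW w_gt0.
  by have [s' ? ?] := sqrt_step tau0 lt_jq sW accs; exists s'.
- by move=> s [_ [sW _]]; rewrite /= sW.
- split=> //; split=> // k; rewrite subn0.
  by apply: acc_le (acc3 k); rewrite ?leq_addr.
have acc_lam (k : 'I_n.+2) : acc u (D + (C + 2)) (lam k) (s4 (rT k)).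
  have := acc4 k; rewrite subnn mul1n; apply: acc_trans => //.
  by apply: acc_iter_sqrt (lam_trace k q) => //; apply: ltW.
have [s5 exec5 acc5] := @quotient_step s4 (fun k => lam k) _ (fun k => lam_gt0 k) acc_lam.
exists s5 => [|k].
  apply: ExecSeq exec1 _; apply: ExecSeq exec2 _; apply: ExecSeq exec3 _.
  exact: ExecSeq exec4 exec5.
have k1 : (inord k.+1 : 'I_n.+2) = k.+1 :> nat by rewrite inordK // ltnS ltn_ord.
have k0 : (inord k : 'I_n.+2) = k :> nat by rewrite inordK // ltnW // ltnS ltn_ord.
by have := acc5 k; rewrite k1 k0.
Qed.

End Run.
End Program.

(** The exponent comes from [n] and from the expressions for the minors, so it depends neither on
    the nodes nor on the arithmetic. *)
Lemma singular_values_HRA (R : realType) (n : nat) :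
  HRA_computable (O := 'I_n.+1)
    (fun t : 'rV[R]_n.+1 => neg_decreasing t)
    (fun t y => is_singular_values (vander t) y).
Proof.
have [e [m [e_below e_acc]]] := hexpr_family (@hexpr_compound R n).
pose D := #|{set 'I_n.+1}|.
pose E := (D + ((m + D + 1) + 2) + (D + ((m + D + 1) + 2))).+2.
exists (svd_program e), (fun i : 'I_n.+1 => @svd_out n (inord i.+1)).
exists (2 ^+ E.+1); split; first by rewrite exprn_gt0.
move=> t t_nd; split=> [|y /singular_values_vanderJ yP A].
  have [y yP] := singular_values_ex (vanderJ t).
  by exists y; apply/singular_values_vanderJ.
have [y_ge0 y_dec _] := yP.
have y_gt0 := singular_values_gt0 (lt0r_neq0 (det_vanderJ_gt0 t_nd)) yP.
have top_gt0 k : 0 < top_prod y k by apply: prodr_gt0 => i _; rewrite exprn_gt0.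
pose B := (vanderJ t)^T *m vanderJ t.
have [|||||j|s exec_s acc_s] := @exec_svd_program n R A e m
  (fun j => compound (B ^+ (2 ^ j))) _ _ (init_store t) _ _ (top_prod y).
- by move=> j ST; apply: compound_ge0.
- move=> j S T; rewrite -compoundM; congr (compound _ _).
  by rewrite expnS mul2n -addnn exprD.
- exact: e_below.
- by move=> ST; rewrite expn0 expr1; apply: e_acc.
- exact: top_gt0.
- move=> p; rewrite -trace_minors_compound (trace_minors_gram _ _ yP).
  by apply: sum_prod_top => //; rewrite -ltnS.
exists s => // i; apply: acc_rel; first exact: roundoff_gt0.
  exact: roundoff_le.
(* Consecutive values of [top_prod] have the quotient [y_i^2]. *)
have := acc_s i; rewrite top_prodS mulrAC divff ?gt_eqF // mul1r sqrtr_sqr.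
by rewrite ger0_norm.
Qed.

(** * Total positivity and the four accurate computations together *)

Theorem proposition1 (R : realType) (n : nat) (hn : (1 <= n)%N) :
  [/\ (forall t : 'rV[R]_n.+1, STP (vanderJ t) <-> neg_decreasing t),
      (* bidiagonal decomposition of V_J *)
      HRA_computable (O := ('I_(n.*2.+1) * 'I_n.+1 * 'I_n.+1)%type)
        (fun t : 'rV[R]_n.+1 => neg_decreasing t)
        (fun t y => forall (l : 'I_(n.*2.+1)) (i j : 'I_n.+1),
           y (l, i, j) = bd_factor (vanderJ t) l i j),
      (* singular values of V *)
      HRA_computable (O := 'I_n.+1)
        (fun t : 'rV[R]_n.+1 => neg_decreasing t)
        (fun t y => is_singular_values (vander t) y),
      (* inverse of V *)
      HRA_computable (O := ('I_n.+1 * 'I_n.+1)%type)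
        (fun t : 'rV[R]_n.+1 => neg_decreasing t)
        (fun t y => forall i j : 'I_n.+1, y (i, j) = invmx (vander t) i j) &
      (* solution c of V c = d; the initial data are t followed by d *)
      HRA_computable (O := 'I_n.+1)
        (fun x : 'rV[R]_(n.+1 + n.+1) =>
           neg_decreasing (lsubmx x) /\ alternating (rsubmx x))
        (fun x y => vander (lsubmx x) *m (\col_i y i) = (rsubmx x)^T)].
Proof.
split; first by move=> t; apply: vanderJ_STP.
- exact: bidiagonal_HRA.
- exact: singular_values_HRA.
- exact: inverse_HRA.
- exact: solve_HRA.
Qed.
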